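(* Let $(\widetilde{\mathbf{x}},\widetilde{Q})$ be a seed in $\mathbb{C}[\mathrm{Gr}_{k,n}]$, with cluster $\mathbf{x}$ and principal part $Q$ of $\widetilde{Q}$. Then $(\pi(\overleftarrow{\mathbf{x}}),Q)$ is a seed in $\mathbb{C}[\mathrm{Gr}_{k,n}]_1$, where $\pi(\overleftarrow{\mathbf{x}})$ is obtained by applying the twist and then $\pi$ to each element of $\mathbf{x}$. In particular, if $x$ is a cluster variable in $\mathbb{C}[\mathrm{Gr}_{k,n}]$, then $\pi(\overleftarrow{x})$ is a cluster variable in $\mathbb{C}[\mathrm{Gr}_{k,n}]_1$, and hence of the form $\pi(y)$ for some cluster variable $y$ in $\mathbb{C}[\mathrm{Gr}_{k,n}]$.
   Context: Let $2\le k\le n-2$. $M_{k,n}$ is the set of complex $k\times n$ matrices $p$ with columns $p_1,\dots,p_n$; for a $k$-subset $I$ of $\{1,\dots,n\}$, $[I]$ is the minor with column set $I$ in increasing order. $\mathbb{C}[\mathrm{Gr}_{k,n}]$ is the subalgebra of $\mathbb{C}[M_{k,n}]$ generated by all $[I]$. Let $\sigma(i)=i-1$ mod $n$ and $\mathbf{i}=\{\sigma^{k-1}(i),\dots,\sigma(i),i\}$; the $[\mathbf{i}]$, $1\le i\le n$, are called coefficients. **Twist.** For $v_1,\dots,v_{k-1}\in\mathbb{C}^k$, $v_1\times\cdots\times v_{k-1}$ is the unique vector with $(v_1\times\cdots\times v_{k-1})^Tv=\det(v_1,\dots,v_{k-1},v)$ for all $v$. $\overleftarrow{p}$ has $i$th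 column $\varepsilon_i\, p_{\sigma^{k-1}(i)}\times\cdots\times p_{\sigma(i)}$, with $\varepsilon_i=(-1)^{i(k-i)}$ if $i\le k-1$ and $\varepsilon_i=1$ if $i\ge k$; $\overleftarrow{f}(p)=f(\overleftarrow{p})$ for $f\in\mathbb{C}[\mathrm{Gr}_{k,n}]$. **Cluster structure and $\pi$.** For $0\le i\le k-1$, $1\le j\le n-k$, or $(i,j)=(0,0)$, let $M_{k,n}(i,j)=\{1,\dots,i\}\cup\{i+j+1,\dots,j+k\}$, with $M_{k,n}(0,0)=\{1,\dots,k\}$. $\mathbb{C}[\mathrm{Gr}_{k,n}]$ is a cluster algebra (of geometric type, coefficients not inverted) with an initial seed whose extended cluster consists of all $[M_{k,n}(i,j)]$. The cluster $\mathbf{x}(\mathcal{R}_{k,n})$ consists of those with $1\le i\le k-1$, $1\le j\le n-k-1$, and the others are exactly the coefficients $[\mathbf{1}],\dots,[\mathbf{n}]$ (frozen). Its quiver $\widetilde{Q}(\mathcal{R}_{k,n})$ has arrows $(i+1,j)\to(i,j)$, $(i,j)\to(i,j+1)$, $(i,j+1)\to(i+1,j)$ whenever both vertices are in the range $0\le i\le k-1,\ 1\le j\le n-k$ and not both are frozen, together with $(0,0)\to(k-1,1)$. The seeds of $\mathbb{C}[\mathrm{Gr}_{k,n}]$ are the pairs $(\widetilde{\mathbf{x}},\widetilde{Q})$ obtained from this one by iterated mutation at non-frozen vertices. For a seed, the cluster $\mathbf{x}$ consists of the non-coefficient elements of $\widetilde{\mathbf{x}}$ (the cluster variables), and the principal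 part $Q$ is the full subquiver of $\widetilde{Q}$ on the non-frozen vertices. $\mathbb{C}[\mathrm{Gr}_{k,n}]_1$ is the cluster algebra (without coefficients) in $\mathbb{C}(\mathbf{x}(\mathcal{R}_{k,n}))$ with initial seed $(\mathbf{x}(\mathcal{R}_{k,n}),Q(\mathcal{R}_{k,n}))$, where $Q(\mathcal{R}_{k,n})$ is the principal part of $\widetilde{Q}(\mathcal{R}_{k,n})$. $\pi:\mathbb{C}[\mathrm{Gr}_{k,n}]\to\mathbb{C}[\mathrm{Gr}_{k,n}]_1$ is the surjective ring homomorphism sending every coefficient to $1$ and each element of $\mathbf{x}(\mathcal{R}_{k,n})$ to itself; it maps cluster variables (surjectively) to cluster variables and each seed $(\widetilde{\mathbf{x}},\widetilde{Q})$ to a seed $(\pi(\mathbf{x}),Q)$, compatibly with mutation. *)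

(* Defs.v *)
From mathcomp Require Import all_boot all_order all_algebra all_fingroup.
From mathcomp Require Import complex mpoly.
From mathcomp Require Import boolp reals.

Set Implicit Arguments.
Unset Strict Implicit.
Unset Printing Implicit Defensive.

Import GRing.Theory.
Local Open Scope ring_scope.

(** * Quivers, seeds and mutation *)

(* [seed_quiver s u w] is the number of arrows [u -> w]. *)
Record seed (V : finType) (K : fieldType) := Seed {
  seed_var : V -> K;
  seed_quiver : V -> V -> nat }.

(* Away from [v]: the arrows [u -> w] together with one new arrow for each path
   [u -> v -> w], after cancellation of 2-cycles (truncated subtraction);
   arrows between two frozen vertices are discarded. *)
Definition mutate_quiver (V : finType) (frozen : pred V) (Q : V -> V -> nat)
    (v u w : V) : nat :=
  if (u == v) || (w == v) then Q w u
  else if frozen u && frozen w then 0%N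
  else ((Q u w + Q u v * Q v w) - (Q w u + Q w v * Q v u))%N.

Definition exchange (V : finType) (K : fieldType) (s : seed V K) (v : V) : K :=
  (\prod_u seed_var s u ^+ seed_quiver s u v +
   \prod_u seed_var s u ^+ seed_quiver s v u) / seed_var s v.

Definition mutate (V : finType) (frozen : pred V) (K : fieldType)
    (s : seed V K) (v : V) : seed V K :=
  Seed (fun u => if u == v then exchange s v else seed_var s u)
       (mutate_quiver frozen (seed_quiver s) v).

Inductive reachable (V : finType) (frozen : pred V) (K : fieldType)
    (s0 : seed V K) : seed V K -> Prop :=
| reachable_init : reachable frozen s0 s0
| reachable_mutate s v :
    ~~ frozen v -> reachable frozen s0 s ->
    reachable frozen s0 (mutate frozen s v).

(* The vertices of the quiver of a seed are the elements of its extended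
   cluster, so the labelling by [V] is only relevant up to a permutation. *)
Definition is_seed (V : finType) (frozen : pred V) (K : fieldType)
    (s0 s : seed V K) : Prop :=
  exists (t : seed V K) (a : {perm V}),
    [/\ reachable frozen s0 t,
        forall v, frozen (a v) = frozen v,
        forall v, seed_var s v = seed_var t (a v) &
        forall u v, seed_quiver s u v = seed_quiver t (a u) (a v)].

Definition is_cluster_variable (V : finType) (frozen : pred V) (K : fieldType)
    (s0 : seed V K) (x : K) : Prop :=
  exists s v, [/\ is_seed frozen s0 s, ~~ frozen v & x = seed_var s v].

Definition principal_part (V : finType) (frozen : pred V) (K : fieldType)
    (s : seed V K) : seed {v : V | ~~ frozen v} K :=
  Seed (fun v => seed_var s (val v))
       (fun u v => seed_quiver s (val u) (val v)).

Definition map_seed (V : finType) (K : fieldType) (f : K -> K)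
    (s : seed V K) : seed V K :=
  Seed (fun v => f (seed_var s v)) (seed_quiver s).

(* The subalgebra generated by [S], for the algebra structure [iota]. *)
Inductive generated (F A : nzRingType) (iota : F -> A) (S : A -> Prop) :
    A -> Prop :=
| generated_scalar c : generated iota S (iota c)
| generated_gen a : S a -> generated iota S a
| generated_add a b :
    generated iota S a -> generated iota S b -> generated iota S (a + b)
| generated_mul a b :
    generated iota S a -> generated iota S b -> generated iota S (a * b).

(** * Minors and the coordinate ring of the Grassmannian *)

(* Column number [a] in {1, ..., n} is the ordinal [c : 'I_n] with [c.+1 = a]. *)

(* [enum I] lists [I] in increasing order; meaningful when [#|I| = k]. *)
Definition minor (A : comNzRingType) (k n : nat) (p : 'M[A]_(k, n))
    (I : {set 'I_n}) : A :=
  \det (\matrix_(r < k, j < k) nth 0 [seq p r c | c <- enum I] j).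

(* C[M_{k,n}] *)
Definition coordM (R : realType) (k n : nat) := {mpoly R[i][(k * n)%N]}.

(* The field of fractions of C[M_{k,n}]; it contains C[Gr_{k,n}] and the
   subfield C(x(R_{k,n})) generated by the initial cluster. *)
Definition fracM (R : realType) (k n : nat) := {fraction (coordM R k n)}.

Definition genericM (R : realType) (k n : nat) : 'M[coordM R k n]_(k, n) :=
  vec_mx (\row_i 'X_i).

Definition plucker (R : realType) (k n : nat) (I : {set 'I_n}) : coordM R k n :=
  minor (genericM R k n) I.

Definition is_plucker (R : realType) (k n : nat) (f : coordM R k n) : Prop :=
  exists I : {set 'I_n}, #|I| = k /\ f = plucker R k I.

Definition coordGr (R : realType) (k n : nat) : coordM R k n -> Prop :=
  generated (fun c : R[i] => c%:MP) (@is_plucker R k n).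

(* [sigma] is the library's [ord_pred]. *)
Definition coef_set (k n : nat) (c : 'I_n) : {set 'I_n} :=
  [set iter (val m) (@ord_pred n) c | m : 'I_k].

(** * The twist *)

(* The matrix with columns [v 0, ..., v (k - 2), u]. *)
Definition app_mx (A : comNzRingType) (k : nat) (v : nat -> 'cV[A]_k)
    (u : 'cV[A]_k) : 'M[A]_k :=
  \matrix_(r < k, m < k) (if (m < k.-1)%N then v m else u) r 0.

Definition cross (A : comNzRingType) (k : nat) (v : nat -> 'cV[A]_k) :
    'cV[A]_k :=
  \col_(r < k) \det (app_mx v (delta_mx r 0)).

Lemma crossP (A : comNzRingType) (k : nat) (v : nat -> 'cV[A]_k)
    (u : 'cV[A]_k) :
  (0 < k)%N -> ((cross v)^T *m u) 0 0 = \det (app_mx v u).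
Proof.
case: k v u => // k v u _.
have coE w r : cofactor (app_mx v w) r ord_max = cofactor (app_mx v 0) r ord_max.
  rewrite /cofactor; congr (_ * \det _); apply/matrixP => i j.
  by rewrite !mxE lift_max ltn_ord.
have colE w r : app_mx v w r ord_max = w r 0 by rewrite !mxE ltnn.
rewrite mxE (expand_det_col _ ord_max); apply: eq_bigr => r _.
rewrite coE colE !mxE mulrC (expand_det_col _ ord_max); congr (_ * _).
rewrite (bigD1 r) //= coE colE mxE !eqxx mul1r big1 ?addr0 // => i ne_ir.
by rewrite colE mxE (negPf ne_ir) mul0r.
Qed.

Lemma cross_uniq (A : comNzRingType) (k : nat) (v : nat -> 'cV[A]_k)
    (w : 'cV[A]_k) :
  (forall u : 'cV_k, (w^T *m u) 0 0 = \det (app_mx v u)) ->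
  w = cross v.
Proof.
move=> Hw; apply/colP => r; rewrite mxE -Hw mxE (bigD1 r) //= big1 => [|i ne].
  by rewrite !mxE !eqxx mulr1 addr0.
by rewrite !mxE (negPf ne) mulr0.
Qed.

Definition twist_sign (A : comNzRingType) (k a : nat) : A :=
  if (a <= k.-1)%N then (-1) ^+ (a * (k - a)) else 1.

Definition twist_mx (A : comNzRingType) (k n : nat) (p : 'M[A]_(k, n)) :
    'M[A]_(k, n) :=
  \matrix_(r < k, c < n)
    (twist_sign A k c.+1 *
     cross (fun m => col (iter (k.-1 - m) (@ord_pred n) c) p) r 0).

Definition twist (R : realType) (k n : nat) (f : coordM R k n) : coordM R k n :=
  f \mPo [tuple mxvec (twist_mx (genericM R k n)) 0 i | i < (k * n)%N].

(** * The cluster structure *)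

(* [None] is the vertex (0,0) and [Some (i, j)] is the vertex (i, j+1). *)
Definition vertex (k n : nat) : finType := option ('I_k * 'I_(n - k)).

Definition vertex_i (k n : nat) (v : vertex k n) : nat :=
  if v is Some (i, _) then i else 0%N.

Definition vertex_j (k n : nat) (v : vertex k n) : nat :=
  if v is Some (_, j) then j.+1 else 0%N.

Definition frozen (k n : nat) : pred (vertex k n) := fun v =>
  ~~ ((1 <= vertex_i v <= k - 1) && (1 <= vertex_j v <= n - k - 1))%N.

Definition vertex_set (k n : nat) (v : vertex k n) : {set 'I_n} :=
  let i := vertex_i v in let j := vertex_j v in
  [set c : 'I_n | (1 <= c.+1 <= i)%N || (i + j + 1 <= c.+1 <= j + k)%N].

Definition arrow (k n : nat) (u v : vertex k n) : bool :=
  ~~ (frozen u && frozen v) &&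
  match u, v with
  | Some _, Some _ =>
      let i := vertex_i u in let j := vertex_j u in
      let i' := vertex_i v in let j' := vertex_j v in
      [|| (i == i'.+1) && (j == j'), (i' == i) && (j' == j.+1)
        | (i' == i.+1) && (j == j'.+1)]
  | None, Some _ => (vertex_i v == k - 1)%N && (vertex_j v == 1)%N
  | _, None => false
  end.

Definition initial_seed (R : realType) (k n : nat) :
    seed (vertex k n) (fracM R k n) :=
  Seed (fun v => tofrac (plucker R k (vertex_set v)))
       (fun u v => nat_of_bool (arrow u v)).

Definition seed_Gr (R : realType) (k n : nat) :=
  is_seed (@frozen k n) (initial_seed R k n).

Definition cluster_variable_Gr (R : realType) (k n : nat) :=
  is_cluster_variable (@frozen k n) (initial_seed R k n).

Definition mutable (k n : nat) := {v : vertex k n | ~~ frozen v}.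

Definition initial_seed1 (R : realType) (k n : nat) :
    seed (mutable k n) (fracM R k n) :=
  principal_part (@frozen k n) (initial_seed R k n).

Definition seed_Gr1 (R : realType) (k n : nat) :=
  is_seed xpred0 (initial_seed1 R k n).

Definition cluster_variable_Gr1 (R : realType) (k n : nat) :=
  is_cluster_variable xpred0 (initial_seed1 R k n).

(* C[Gr_{k,n}]_1 *)
Definition coordGr1 (R : realType) (k n : nat) : fracM R k n -> Prop :=
  generated (fun c : R[i] => tofrac (c%:MP : coordM R k n))
            (@cluster_variable_Gr1 R k n).

(** * The projection *)

(* The map is only constrained on C[Gr_{k,n}]. *)
Definition is_projection (R : realType) (k n : nat)
    (pi : coordM R k n -> fracM R k n) : Prop :=
  [/\ [/\ pi 1 = 1,
          forall f g, coordGr f -> coordGr g -> pi (f + g) = pi f + pi g &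
          forall f g, coordGr f -> coordGr g -> pi (f * g) = pi f * pi g],
      forall f, coordGr f -> coordGr1 (pi f),
      forall z, coordGr1 z -> exists2 f, coordGr f & pi f = z,
      forall c : 'I_n, pi (plucker R k (coef_set k c)) = 1 &
      forall v : vertex k n, ~~ frozen v ->
        pi (plucker R k (vertex_set v)) = tofrac (plucker R k (vertex_set v))].

(* Cluster variables are defined by exchange relations in the field of
   fractions, whereas [pi] and the twist act on C[Gr_{k,n}].  A ring
   homomorphism [phi] on C[Gr_{k,n}] is therefore evaluated on an element [h]
   of the field through its canonical extension to the fractions [f / g] with
   [phi g != 0] (and given the value 0 elsewhere).  For [h] in C[Gr_{k,n}] this
   is [phi h], see [evalE]; by Scott's theorem that covers every cluster
   variable. *)
Definition has_value (R : realType) (k n : nat)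
    (phi : coordM R k n -> fracM R k n) (h r : fracM R k n) : Prop :=
  exists f g, [/\ coordGr f, coordGr g, phi g != 0,
                  h = tofrac f / tofrac g & r = phi f / phi g].

Definition eval (R : realType) (k n : nat)
    (phi : coordM R k n -> fracM R k n) (h : fracM R k n) : fracM R k n :=
  if pselect (exists r, has_value phi h r) is left hr
  then projT1 (cid hr) else 0.

Lemma evalE (R : realType) (k n : nat) (phi : coordM R k n -> fracM R k n)
    (f : coordM R k n) :
  phi 1 = 1 ->
  (forall a b, coordGr a -> coordGr b -> phi (a + b) = phi a + phi b) ->
  (forall a b, coordGr a -> coordGr b -> phi (a * b) = phi a * phi b) ->
  coordGr f -> eval phi (tofrac f) = phi f.
Proof.
move=> phi1 phiD phiM Gf.
have G0 : coordGr (0 : coordM R k n).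
  by rewrite -(mpolyC0 _ R[i]); apply: generated_scalar.
have G1 : coordGr (1 : coordM R k n).
  by rewrite -(mpolyC1 _ R[i]); apply: generated_scalar.
have phi0 : phi 0 = 0.
  by apply: (addrI (phi 0)); rewrite -phiD // !addr0.
rewrite /eval; case: pselect => [hr|[]]; last first.
  exists (phi f), f, 1; split=> //; first by rewrite phi1 oner_neq0.
    by rewrite tofrac1 divr1.
  by rewrite phi1 divr1.
case: (cid hr) => r /= [a [b [Ga Gb nzb eqf ->]]].
have nzFb : tofrac b != 0.
  by rewrite tofrac_eq0; apply: contraNneq nzb => ->; rewrite phi0.
have /eqP : tofrac f * tofrac b = tofrac a by rewrite eqf divfK.
rewrite -tofracM tofrac_eq => /eqP <-.
by rewrite phiM // mulfK.
Qed.

(* Main.v *)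
Require Import Defs.
From mathcomp Require Import all_boot all_order all_algebra all_fingroup.
From mathcomp Require Import complex mpoly zify.
From mathcomp Require Import boolp reals.

(** Write [psi] for the twist followed by the projection [pi].

    An exchange relation only involves sums, products and one division.  A ring
    homomorphism on C[Gr] which sends every coefficient to 1 therefore carries
    the seeds of C[Gr], mutation by mutation, to the seeds without coefficients
    obtained from the image of the initial seed, provided that no cluster
    variable met on the way is sent to 0 ([specialize_reachable]; conversely
    [lift_reachable] lifts every seed without coefficients, which gives the
    last assertion).  The provision holds because exchange relations are
    subtraction-free: if all variables of a seed are positive at some totally
    positive matrix, this remains so under mutation ([positive_reachable]).  It remains to see that
    [psi] is a homomorphism on C[Gr] with value 1 at the coefficients, and that
    the image under [psi] of the initial seed is a seed of C[Gr]_1.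

    The twisted column [c] is the cross product of the [k - 1] columns which
    precede [c] cyclically.  Continue the columns quasi-periodically by
    [p_(m + n) = (-1)^(k - 1) p_m]; this absorbs all the signs.  The scalar
    product of the twisted column [c] with the column [d] is then the
    determinant of columns [c - k + 1, ..., c - 1, d], which is 0 for
    [c - k < d < c] and the coefficient ending at [c] for [d = c].  Multiplying
    the matrix of a twisted minor by a well-chosen matrix of columns thus gives
    block triangular matrices with coefficients on the diagonal.  Doing this for
    a twisted initial minor and for a twisted interval leaves the same unknown
    block, and comparing both yields
    [psi [M(i,j)] = pi [{j+1, ..., j+i} U {n-k+i+1, ..., n}]]
    ([proj_twist_stair]), and [psi = 1] on coefficients.

    Finally, these minors form a seed.  The minors on [{1, ..., a}], an interval
    and [{n - c + 1, ..., n}] satisfy three-term Pluecker relations of the shape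
    of the octahedron recurrence ([stair_exchange]).  From the initial seed,
    where [c = 0], mutate every vertex [(i, j)] exactly [i] times; each mutation
    decreases [a] and increases [c], until [a = 0].  The quivers along the way
    are those of height functions on the grid, the mutations being made at local
    minima ([mutate_height_quiver]), so that each exchange relation is one of
    the three-term relations ([reach_final]).  The last seed is the image seed
    up to the relabelling [(i, j) -> (k - i, j)] ([twist_seed_relabels]). *)

Set Implicit Arguments.
Unset Strict Implicit.
Unset Printing Implicit Defensive.

Import GRing.Theory.
Local Open Scope ring_scope.

(** * Relabelling of seeds *)

Definition relabels (V : finType) (K : fieldType) (a : V -> V)
    (s t : seed V K) : Prop :=
  (forall v, seed_var s v = seed_var t (a v)) /\
  (forall u v, seed_quiver s u v = seed_quiver t (a u) (a v)).

Lemma relabels_mutate (V : finType) (frozen : pred V) (K : fieldType)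
    (a : {perm V}) (s t : seed V K) (v : V) :
  (forall v, frozen (a v) = frozen v) -> relabels a s t ->
  relabels a (mutate frozen s v) (mutate frozen t (a v)).
Proof.
move=> fa [Hv Hq]; split=> [u | u w] /=; last first.
  by rewrite /mutate_quiver !(inj_eq perm_inj) !fa !Hq.
rewrite (inj_eq perm_inj) /exchange Hv.
rewrite [\prod_i seed_var t i ^+ seed_quiver t i (a v)](reindex_inj (@perm_inj _ a)).
rewrite [\prod_i seed_var t i ^+ seed_quiver t (a v) i](reindex_inj (@perm_inj _ a)).
by case: eqP => // _; congr ((_ + _) / _); apply: eq_bigr => i _; rewrite Hv Hq.
Qed.

Lemma is_seed_refl (V : finType) (frozen : pred V) (K : fieldType) (s : seed V K) :
  is_seed frozen s s.
Proof.
exists s, 1%g; split=> [|v|v|u v]; rewrite ?perm1 //; exact: reachable_init.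
Qed.

(** Mutations commute with relabellings, so a path of mutations starting at a
    relabelled seed can be transported to the seed itself. *)
Lemma is_seed_reachable (V : finType) (frozen : pred V) (K : fieldType)
    (s0 s s' : seed V K) :
  is_seed frozen s0 s -> reachable frozen s s' -> is_seed frozen s0 s'.
Proof.
move=> seed_s; elim=> // {}s' v fv _ [t [a [rt fa Hv Hq]]].
have [Hv' Hq'] := relabels_mutate v fa (conj Hv Hq).
by exists (mutate frozen t (a v)), a; split=> //; apply: reachable_mutate; rewrite ?fa.
Qed.

Lemma is_seed_relabels (V : finType) (frozen : pred V) (K : fieldType)
    (a : {perm V}) (s0 s t : seed V K) :
  (forall v, frozen (a v) = frozen v) -> relabels a s t ->
  is_seed frozen s0 t -> is_seed frozen s0 s.
Proof.
move=> fa [Hv Hq] [u [b [ru fb Hv' Hq']]]; exists u, (a * b)%g; split=> //.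
- by move=> v; rewrite permM fb fa.
- by move=> v; rewrite permM Hv Hv'.
- by move=> v w; rewrite !permM Hq Hq'.
Qed.

Section RestrictPerm.
Variables (V : finType) (P : pred V) (a : {perm V}).
Hypothesis Pa : forall v, P (a v) = P v.

Definition restrict_fun (v : {v | P v}) : {v | P v} :=
  Sub (a (val v)) (etrans (Pa (val v)) (valP v)).

Lemma restrict_inj : injective restrict_fun.
Proof. by move=> u v /(congr1 val) /= /perm_inj /val_inj. Qed.

Definition restrict_perm : {perm {v | P v}} := perm restrict_inj.

Lemma val_restrict v : val (restrict_perm v) = a (val v).
Proof. by rewrite permE. Qed.
End RestrictPerm.

(** * Values of a homomorphism along mutations *)

Section Values.
Variables (A : comNzRingType) (F : fieldType) (iota : {rmorphism A -> F}).
Hypothesis iota_inj : injective iota.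
Variable G : A -> Prop.
Hypotheses (G1 : G 1) (GD : forall f g, G f -> G g -> G (f + g)).
Hypothesis GM : forall f g, G f -> G g -> G (f * g).
Variable phi : A -> F.
Hypotheses (phi0 : phi 0 = 0) (phi1 : phi 1 = 1).
Hypothesis phiD : forall f g, G f -> G g -> phi (f + g) = phi f + phi g.
Hypothesis phiM : forall f g, G f -> G g -> phi (f * g) = phi f * phi g.

(** The graph of the extension of [phi], given on the subring [G], to the
    fractions whose denominator it does not kill; this is [has_value] over an
    arbitrary ring. *)
Definition frac_value (h r : F) : Prop :=
  exists f g, [/\ G f, G g, phi g != 0, h = iota f / iota g & r = phi f / phi g].

Lemma iota_phi_neq0 g : phi g != 0 -> iota g != 0.
Proof.
apply: contraNneq => g0; have -> : g = 0 by apply: iota_inj; rewrite rmorph0.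
by rewrite phi0.
Qed.

Lemma frac_value_uniq h r r' : frac_value h r -> frac_value h r' -> r = r'.
Proof.
move=> [f [g [Gf Gg nzg -> ->]]] [f' [g' [Gf' Gg' nzg' eq_h ->]]].
have eq_fg : f * g' = f' * g.
  apply/iota_inj/eqP; rewrite !rmorphM.
  by rewrite -(eqr_div _ _ (iota_phi_neq0 nzg) (iota_phi_neq0 nzg')) eq_h.
by apply/eqP; rewrite (eqr_div _ _ nzg nzg') -!phiM // eq_fg.
Qed.

Lemma frac_value_iota f : G f -> frac_value (iota f) (phi f).
Proof. by move=> Gf; exists f, 1; rewrite phi1 rmorph1 !divr1 oner_neq0. Qed.

Lemma frac_value1 : frac_value 1 1.
Proof. by have := frac_value_iota G1; rewrite phi1 rmorph1. Qed.

Lemma frac_valueD x y r s :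
  frac_value x r -> frac_value y s -> frac_value (x + y) (r + s).
Proof.
move=> [f [g [Gf Gg nzg -> ->]]] [f' [g' [Gf' Gg' nzg' -> ->]]].
exists (f * g' + f' * g), (g * g'); split; try by do ?[apply: GD]; apply: GM.
- by rewrite phiM // mulf_neq0.
- by rewrite rmorphD !rmorphM addf_div ?iota_phi_neq0.
- by rewrite phiD ?phiM ?addf_div //; apply: GM.
Qed.

Lemma frac_valueM x y r s :
  frac_value x r -> frac_value y s -> frac_value (x * y) (r * s).
Proof.
move=> [f [g [Gf Gg nzg -> ->]]] [f' [g' [Gf' Gg' nzg' -> ->]]].
exists (f * f'), (g * g'); split; try exact: GM.
- by rewrite phiM // mulf_neq0.
- by rewrite !rmorphM mulf_div.
- by rewrite !phiM // mulf_div.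
Qed.

Lemma frac_valueV x r : r != 0 -> frac_value x r -> frac_value x^-1 r^-1.
Proof.
move=> nz_r [f [g [Gf Gg nzg -> eq_r]]]; exists g, f; split=> //.
- by apply: contraNneq nz_r => phif; rewrite eq_r phif mul0r.
- by rewrite invf_div.
- by rewrite eq_r invf_div.
Qed.

Lemma frac_valueX x r m : frac_value x r -> frac_value (x ^+ m) (r ^+ m).
Proof.
move=> hx; elim: m => [|m IHm]; first exact: frac_value1.
by rewrite !exprS; apply: frac_valueM.
Qed.

Lemma frac_value_prod (I : finType) (x r : I -> F) :
  (forall i, frac_value (x i) (r i)) -> frac_value (\prod_i x i) (\prod_i r i).
Proof.
move=> hx; apply: (big_rec2 frac_value); first exact: frac_value1.
by move=> i y z _; apply: frac_valueM.
Qed.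

Section Specialize.
Variables (V : finType) (frozen : pred V).

(** [t1] is the seed without coefficients obtained from [t] by applying [phi],
    which sends the frozen variables to 1. *)
Definition specializes (t : seed V F)
    (t1 : seed {v : V | ~~ frozen v} F) : Prop :=
  [/\ forall v, frozen v -> frac_value (seed_var t v) 1,
      forall v, frac_value (seed_var t (val v)) (seed_var t1 v) &
      forall u v, seed_quiver t1 u v = seed_quiver t (val u) (val v)].

(** The frozen variables contribute factors 1, so that the monomial over all
    vertices is sent to the monomial over the mutable ones. *)
Lemma specializes_prod t t1 (e : V -> nat) : specializes t t1 ->
  frac_value (\prod_u seed_var t u ^+ e u)
    (\prod_u seed_var t1 u ^+ e (val u)).
Proof.
case=> [tF tM _].
pose r v := if insub v is Some u then seed_var t1 u else 1.
have -> : \prod_u seed_var t1 u ^+ e (val u) = \prod_v r v ^+ e v.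
  rewrite [RHS](bigID (fun v => ~~ frozen v)) /= [X in _ * X]big1 ?mulr1.
    rewrite (big_sub [pred v | ~~ frozen v]).
    by apply: eq_bigr => u _; rewrite /r valK.
  by move=> v; rewrite negbK => fv; rewrite /r insubN ?negbK // expr1n.
apply: frac_value_prod => v; apply: frac_valueX; rewrite /r.
by case: insubP => [u _ <- | /negbNE/tF].
Qed.

Lemma specializes_mutate t t1 (v : {v : V | ~~ frozen v}) :
  seed_var t1 v != 0 -> specializes t t1 ->
  specializes (mutate frozen t (val v)) (mutate xpred0 t1 v).
Proof.
move=> nz_v spec; have [tF tM tQ] := spec; split=> [u fu | u | u w] /=.
- case: eqP => [eq_u | _]; last exact: tF.
  by rewrite eq_u (negPf (valP v)) in fu.
- rewrite (inj_eq val_inj); case: eqP => [_|_]; last exact: tM.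
  rewrite /exchange; apply: frac_valueM; last by apply: frac_valueV (tM v).
  have prodE (e : V -> nat) (e1 : {v | ~~ frozen v} -> nat) :
      (forall u, e1 u = e (val u)) ->
      frac_value (\prod_u seed_var t u ^+ e u) (\prod_u seed_var t1 u ^+ e1 u).
    move=> eq_e; rewrite (eq_bigr _ (fun u _ => congr1 _ (eq_e u))).
    exact: specializes_prod.
  apply: frac_valueD.
    by apply: (prodE (fun u => seed_quiver t u (val v))) => w; rewrite tQ.
  by apply: (prodE (seed_quiver t (val v))) => w; rewrite tQ.
- by rewrite /mutate_quiver !tQ !(inj_eq val_inj) (negPf (valP u)).
Qed.

End Specialize.
End Values.

(** * Positivity *)

Section Positive.
Variables (A : comNzRingType) (F : fieldType) (iota : {rmorphism A -> F}).
Hypothesis iota_inj : injective iota.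
Variables (C : numFieldType) (ev : {rmorphism A -> C}).

(** Positivity at a point [ev] is kept by sums, products and quotients, hence by
    exchange relations, and so keeps all cluster variables away from 0. *)
Definition positive (x : F) : Prop :=
  exists f g : A, [/\ 0 < ev f, 0 < ev g & x = iota f / iota g].

Lemma iota_pos_neq0 f : 0 < ev f -> iota f != 0.
Proof.
apply: contraTneq => f0; have -> : f = 0 by apply: iota_inj; rewrite rmorph0.
by rewrite rmorph0 Order.POrderTheory.ltxx.
Qed.

Lemma positive_neq0 x : positive x -> x != 0.
Proof.
by case=> f [g [f0 g0 ->]]; rewrite mulf_neq0 ?invr_eq0 ?iota_pos_neq0.
Qed.

Lemma positive_iota f : 0 < ev f -> positive (iota f).
Proof. by exists f, 1; rewrite !rmorph1 divr1 Num.Theory.ltr01. Qed.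

Lemma positive1 : positive 1.
Proof.
by rewrite -(rmorph1 iota); apply: positive_iota; rewrite rmorph1 Num.Theory.ltr01.
Qed.

Lemma positiveD x y : positive x -> positive y -> positive (x + y).
Proof.
case=> f [g [f0 g0 ->]] [f' [g' [f'0 g'0 ->]]].
exists (f * g' + f' * g), (g * g').
rewrite rmorphD !rmorphM Num.Theory.addr_gt0 ?Num.Theory.mulr_gt0 //; split=> //.
by rewrite rmorphD !rmorphM addf_div // iota_pos_neq0.
Qed.

Lemma positiveM x y : positive x -> positive y -> positive (x * y).
Proof.
case=> f [g [f0 g0 ->]] [f' [g' [f'0 g'0 ->]]].
exists (f * f'), (g * g'); rewrite !rmorphM !Num.Theory.mulr_gt0 //; split=> //.
by rewrite mulf_div.
Qed.

Lemma positiveV x : positive x -> positive x^-1.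
Proof. by case=> f [g [f0 g0 ->]]; exists g, f; rewrite invf_div. Qed.

Lemma positive_prod (I : finType) (x : I -> F) (e : I -> nat) :
  (forall i, positive (x i)) -> positive (\prod_i x i ^+ e i).
Proof.
move=> hx; apply: (big_rec positive); first exact: positive1.
move=> i y _; apply: positiveM; elim: (e i) => [|m IHm]; first exact: positive1.
by rewrite exprS; apply: positiveM.
Qed.

Lemma positive_mutate (V : finType) (frozen : pred V) (s : seed V F)
    (v : V) :
  (forall u, positive (seed_var s u)) ->
  forall u, positive (seed_var (mutate frozen s v) u).
Proof.
move=> hs u /=; case: eqP => // _; apply: positiveM; last exact: positiveV.
by apply: positiveD; apply: positive_prod.
Qed.

Lemma positive_reachable (V : finType) (frozen : pred V)
    (s t : seed V F) :
  (forall u, positive (seed_var s u)) -> reachable frozen s t ->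
  forall u, positive (seed_var t u).
Proof. by move=> hs; elim=> // {}t v _ _; apply: positive_mutate. Qed.


Section SpecializeReachable.
Variable G : A -> Prop.
Hypotheses (G1 : G 1) (GD : forall f g, G f -> G g -> G (f + g)).
Hypothesis GM : forall f g, G f -> G g -> G (f * g).
Variable phi : A -> F.
Hypotheses (phi0 : phi 0 = 0) (phi1 : phi 1 = 1).
Hypothesis phiD : forall f g, G f -> G g -> phi (f + g) = phi f + phi g.
Hypothesis phiM : forall f g, G f -> G g -> phi (f * g) = phi f * phi g.
Variables (V : finType) (frozen : pred V).
Variables (t0 : seed V F).
Variables (s0 : seed {v : V | ~~ frozen v} F).
Hypothesis spec0 : specializes iota G phi t0 s0.
Hypothesis pos0 : forall v, positive (seed_var s0 v).

Lemma specialize_reachable t : reachable frozen t0 t ->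
  exists2 t1, reachable xpred0 s0 t1 & specializes iota G phi t t1.
Proof.
elim=> [|{}t v fv _ [t1 r1 spec1]]; first by exists s0 => //; exact: reachable_init.
exists (mutate xpred0 t1 (Sub v fv)); first exact: reachable_mutate.
suff: specializes iota G phi (mutate frozen t (val (Sub v fv : {v | ~~ frozen v})))
  (mutate xpred0 t1 (Sub v fv)) by [].
apply: specializes_mutate => //.
by apply: positive_neq0; apply: positive_reachable pos0 r1 _.
Qed.

Lemma lift_reachable t1 : reachable xpred0 s0 t1 ->
  exists2 t, reachable frozen t0 t & specializes iota G phi t t1.
Proof.
elim=> [|{}t1 v _ r1 [t r spec1]]; first by exists t0 => //; exact: reachable_init.
exists (mutate frozen t (val v)); first exact: reachable_mutate (valP v) r.
apply: specializes_mutate => //.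
by apply: positive_neq0; apply: positive_reachable pos0 r1 _.
Qed.

End SpecializeReachable.
End Positive.

(** * Quivers of height functions *)

Definition adj (a b : nat) : bool := (a == b.+1) || (b == a.+1).

(** The quiver of a height function on the grid: horizontal arrows go down,
    vertical arrows go up, and a unit square whose four heights are
    [x], [x], [x + 1], [x - 1] has a diagonal between its two vertices of equal
    height, directed so that both triangles are oriented cycles.  A square both of
    whose diagonals join equal heights is itself an oriented cycle and has none. *)
Definition height_arrow (h : nat -> nat -> int) (u w : nat * nat) : bool :=
  [|| [&& u.1 == w.1, adj u.2 w.2 & h w.1 w.2 < h u.1 u.2],
      [&& u.2 == w.2, adj u.1 w.1 & h u.1 u.2 < h w.1 w.2]
    | [&& adj u.1 w.1, adj u.2 w.2, h u.1 u.2 == h w.1 w.2,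
          h u.1 u.2 < h u.1 w.2 & h w.1 u.2 < h u.1 u.2]].

Definition height_raise (h : nat -> nat -> int) (p : nat * nat) (i j : nat) : int :=
  if (i == p.1) && (j == p.2) then h i j + 2 else h i j.

Definition height_function (h : nat -> nat -> int) : Prop :=
  forall i j, ((h i j.+1 == h i j + 1) || (h i j.+1 == h i j - 1)) /\
              ((h i.+1 j == h i j + 1) || (h i.+1 j == h i j - 1)).

Definition local_min (h : nat -> nat -> int) (p : nat * nat) : Prop :=
  (forall j, adj p.2 j -> h p.1 j = h p.1 p.2 + 1) /\
  (forall i, adj p.1 i -> h i p.2 = h p.1 p.2 + 1).

Lemma adjC a b : adj a b = adj b a.
Proof. by rewrite /adj orbC. Qed.

Lemma height_arrow_asym h u w : height_arrow h u w -> height_arrow h w u = false.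
Proof.
rewrite /height_arrow !(adjC w.1) !(adjC w.2) !(eq_sym w.1) !(eq_sym w.2) /adj.
lia.
Qed.

(** No diagonal ends at a local minimum: it would need a neighbour below. *)
Lemma height_arrow_min_in h p u : local_min h p ->
  height_arrow h u p = (u.1 == p.1) && adj u.2 p.2.
Proof.
case: p u => a b [i j] [/= hj hi]; rewrite /height_arrow /=.
case: (boolP (adj i a)) => ia; case: (boolP (adj j b)) => jb; rewrite ?andbF ?orbF //=.
- have := hi i; have := hj j; rewrite !(adjC _ i) !(adjC _ j) ia jb.
  move: ia jb; rewrite /adj => ia jb /(_ isT) Hj /(_ isT) Hi.
  have [ni nj] : i != a /\ j != b by lia.
  by rewrite (negPf ni) (negPf nj) /=; lia.
- have := hi i; rewrite (adjC _ i) ia => /(_ isT).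
  by case: eqVneq => [->|_] /=; lia.
- by have := hj j; rewrite (adjC _ j) jb => /(_ isT); case: eqVneq => [->|_] /=; lia.
Qed.

Lemma height_arrow_min_out h p u : local_min h p ->
  height_arrow h p u = (u.2 == p.2) && adj u.1 p.1.
Proof.
case: p u => a b [i j] [/= hj hi]; rewrite /height_arrow /= (adjC a) (adjC b).
rewrite (eq_sym a) (eq_sym b).
case: (boolP (adj i a)) => ia; case: (boolP (adj j b)) => jb; rewrite ?andbF ?orbF //=.
- have := hi i; have := hj j; rewrite !(adjC _ i) !(adjC _ j) ia jb.
  move: ia jb; rewrite /adj => ia jb /(_ isT) Hj /(_ isT) Hi.
  have [ni nj] : i != a /\ j != b by lia.
  by rewrite (negPf ni) (negPf nj) /=; lia.
- have := hi i; rewrite (adjC _ i) ia => /(_ isT).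
  by case: eqVneq => [->|_] /=; lia.
- by have := hj j; rewrite (adjC _ j) jb => /(_ isT); case: eqVneq => [->|_] /=; lia.
Qed.

Lemma height_function_adj h : height_function h ->
  (forall i j j', adj j j' -> h i j != h i j') /\
  (forall i i' j, adj i i' -> h i j != h i' j).
Proof.
move=> hh; split=> [i j j' | i i' j] /orP[] /eqP ->.
- by have [H1 H2] := hh i j'; lia.
- by have [H1 H2] := hh i j; lia.
- by have [H1 H2] := hh i' j; lia.
- by have [H1 H2] := hh i j; lia.
Qed.

Lemma height_raise_out h p i j :
  (i, j) != p -> height_raise h p i j = h i j.
Proof. by case: p => a b; rewrite /height_raise xpair_eqE => /negPf ->. Qed.

Lemma height_arrow_raise_min h p u : local_min h p ->
  height_arrow (height_raise h p) u p = height_arrow h p u /\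
  height_arrow (height_raise h p) p u = height_arrow h u p.
Proof.
move=> hmin; rewrite (height_arrow_min_in _ hmin) (height_arrow_min_out _ hmin).
case: p u hmin => a b [i j] [/= hj hi]; rewrite /height_arrow /height_raise /=.
rewrite !eqxx (adjC a) (adjC b) (eq_sym a) (eq_sym b).
case: (boolP (adj i a)) => ia; case: (boolP (adj j b)) => jb; rewrite ?andbF ?orbF //=.
- have := hi i; have := hj j; rewrite !(adjC _ i) !(adjC _ j) ia jb.
  move: ia jb; rewrite /adj => ia jb /(_ isT) Hj /(_ isT) Hi.
  have [ni nj] : i != a /\ j != b by lia.
  by rewrite (negPf ni) (negPf nj) /=; lia.
- have := hi i; rewrite (adjC _ i) ia => /(_ isT).
  have ni : i != a by move: ia; rewrite /adj; lia.
  by rewrite (negPf ni) /=; case: eqVneq => [->|_] /=; lia.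
- have := hj j; rewrite (adjC _ j) jb => /(_ isT).
  have nj : j != b by move: jb; rewrite /adj; lia.
  by rewrite (negPf nj) /=; case: eqVneq => [->|_] /=; lia.
Qed.

(** A path through the minimum joins opposite corners of a square having the
    minimum as a third corner.  Raising the minimum turns a square with a
    diagonal into one without, and conversely: this is the new arrow of the
    mutation, possibly cancelling the old diagonal. *)
Lemma height_arrow_raise_path h p u w : height_function h -> local_min h p ->
  u.1 = p.1 -> adj u.2 p.2 -> w.2 = p.2 -> adj w.1 p.1 ->
  [/\ height_arrow h u w = false,
      height_arrow (height_raise h p) w u = false &
      height_arrow (height_raise h p) u w = ~~ height_arrow h w u].
Proof.
case: p u w => a b [i j] [i' j'] hh [/= hj hi] -> {i} jb -> {j'} ia.
have [nj _] := height_function_adj hh; have ne := nj i' _ _ jb.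
have /hj Hj : adj b j by rewrite adjC.
have /hi Hi : adj a i' by rewrite adjC.
rewrite /height_arrow /height_raise /= !eqxx jb ia (adjC a) (adjC b) ia jb /=.
have [ni {}nj] : i' != a /\ j != b by move: ia jb; rewrite /adj; lia.
rewrite (eq_sym a) (eq_sym b) (negPf ni) (negPf nj) /= Hi Hj in ne *.
by split; lia.
Qed.

Lemma height_arrow_raise h p u w : height_function h -> local_min h p ->
  u != p -> w != p ->
  height_arrow (height_raise h p) u w =
  ((height_arrow h u w + height_arrow h u p * height_arrow h p w) -
   (height_arrow h w u + height_arrow h w p * height_arrow h p u))%N :> nat.
Proof.
move=> hh hmin up wp.
rewrite !(height_arrow_min_in _ hmin) !(height_arrow_min_out _ hmin).
case: (boolP [&& u.1 == p.1, adj u.2 p.2, w.2 == p.2 & adj w.1 p.1]) => [|notA].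
  case/and4P=> /eqP u1 u2 /eqP w2 w1.
  have [-> _ ->] := height_arrow_raise_path hh hmin u1 u2 w2 w1.
  rewrite u1 u2 w1 w2 !eqxx /=.
  have -> : (u.2 == p.2) = false by move: u2; rewrite /adj; lia.
  by rewrite ?(andbF, andFb, muln0, mul0n, addn0, add0n); case: height_arrow.
case: (boolP [&& w.1 == p.1, adj w.2 p.2, u.2 == p.2 & adj u.1 p.1]) => [|notB].
  case/and4P=> /eqP w1 w2 /eqP u2 u1.
  have [-> -> _] := height_arrow_raise_path hh hmin w1 w2 u2 u1.
  rewrite u1 u2 w1 w2 !eqxx /=.
  have -> : (w.2 == p.2) = false by move: w2; rewrite /adj; lia.
  by rewrite ?(andbF, andFb, muln0, mul0n, addn0, add0n); case: height_arrow.
rewrite !mulnb -!andbA (negPf notA) (negPf notB) !addn0.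
have -> : height_arrow (height_raise h p) u w = height_arrow h u w.
  case: p u w {hmin} up wp notA notB => a b [i j] [i' j'] /=.
  move=> up wp notA notB; rewrite /height_arrow /=.
  rewrite !(height_raise_out h up) !(height_raise_out h wp).
  congr [|| _, _ | _]; case: (boolP (adj i i')) => //= ii; case: (boolP (adj j j')) => //= jj.
  rewrite !height_raise_out // xpair_eqE.
    apply: contra notB => /andP[/eqP <- /eqP <-].
    by rewrite !eqxx (adjC j') jj ii.
  apply: contra notA => /andP[/eqP <- /eqP <-].
  by rewrite !eqxx (adjC i') jj ii.
by have := @height_arrow_asym h u w; do 2!case: height_arrow => //; move=> /(_ isT).
Qed.

(** Mutation at a local minimum raises it by 2.  At the vertex itself all arrows
    are reversed since all neighbours become lower; elsewhere only the four
    squares around the vertex change. *)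
Lemma mutate_height_quiver (V : finType) (c : V -> nat * nat) h (v u w : V) :
  injective c -> height_function h -> local_min h (c v) ->
  mutate_quiver xpred0 (fun u w => nat_of_bool (height_arrow h (c u) (c w))) v u w =
  height_arrow (height_raise h (c v)) (c u) (c w).
Proof.
move=> c_inj hh hmin; rewrite /mutate_quiver -!(inj_eq c_inj).
case: eqP => [-> | /eqP up]; first by have [_ ->] := height_arrow_raise_min (c w) hmin.
case: eqP => [-> | /eqP wp]; first by have [-> _] := height_arrow_raise_min (c u) hmin.
by rewrite (height_arrow_raise hh hmin up wp).
Qed.

(** * The path of flips *)

Definition mut_i (k n : nat) (v : mutable k n) : nat := vertex_i (val v).
Definition mut_j (k n : nat) (v : mutable k n) : nat := vertex_j (val v).
Definition mut_coord (k n : nat) (v : mutable k n) : nat * nat := (mut_i v, mut_j v).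

Lemma mut_coord_inj (k n : nat) : injective (@mut_coord k n).
Proof.
move=> [[[i j]|] /= fu] [[[i' j']|] /= fv] //; rewrite /mut_coord /mut_i /mut_j /= => -[] /val_inj ei /val_inj ej.
by apply: val_inj; rewrite /= ei ej.
Qed.

Lemma mut_coordP (k n : nat) (v : mutable k n) :
  (0 < mut_i v < k)%N && (0 < mut_j v < n - k)%N.
Proof. by case: v => v; rewrite /mut_i /mut_j /= negbK; lia. Qed.

Lemma mut_coord_ex (k n i j : nat) : (0 < i < k)%N -> (0 < j < n - k)%N ->
  exists v : mutable k n, mut_coord v = (i, j).
Proof.
move=> ik jn; have ik' : (i < k)%N by lia.
have jn' : (j.-1 < n - k)%N by lia.
have mv : ~~ frozen (Some (Ordinal ik', Ordinal jn') : vertex k n).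
  by rewrite negbK /=; lia.
by exists (exist (fun v => ~~ frozen v) _ mv); rewrite /mut_coord /mut_i /mut_j /=; congr pair; lia.
Qed.

(** Here [x i j t] is the variable at the vertex [(i, j)] after [t] mutations of
    that vertex. *)
Section FlipPath.
Variables (F : fieldType) (k n : nat) (x : nat -> nat -> nat -> F).

(** The seed in which [(i, j)] has been mutated [tau i j] times; each mutation
    raises the height by 2. *)
Definition flip_height (tau : nat -> nat -> nat) (i j : nat) : int :=
  (tau i j)%:Z *+ 2 - i%:Z - j%:Z.

Definition flip_seed (tau : nat -> nat -> nat) : seed (mutable k n) F :=
  Seed (fun v => x (mut_i v) (mut_j v) (tau (mut_i v) (mut_j v)))
       (fun u v => nat_of_bool
          (height_arrow (flip_height tau) (mut_coord u) (mut_coord v))).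

Lemma eq_flip_seed tau tau' :
  (forall i j, (0 < i < k)%N -> (0 < j < n - k)%N -> tau i j = tau' i j) ->
  flip_seed tau = flip_seed tau'.
Proof.
move=> eq_tau; rewrite /flip_seed; congr Seed; apply/funext => u.
  by have /andP[ui uj] := mut_coordP u; rewrite eq_tau.
apply/funext => v; congr nat_of_bool.
have /andP[ui uj] := mut_coordP u; have /andP[vi vj] := mut_coordP v.
by rewrite /height_arrow /flip_height !eq_tau.
Qed.

Hypothesis x_boundary : forall i j t, (t <= i <= k)%N -> (j <= n - k)%N ->
  [|| i == 0, i == k, j == 0 | j == (n - k)]%N -> x i j t = 1.
Hypothesis x_exchange : forall i j t, (t < i < k)%N -> (0 < j < n - k)%N ->
  x i j t * x i j t.+1 =
  x i j.-1 t * x i j.+1 t.+1 + x i.-1 j t * x i.+1 j t.+1.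

(** A neighbour outside the mutable grid would be frozen, and contributes 1. *)
Lemma prod_coord (f : nat -> nat -> F) i j : (i <= k)%N -> (j <= n - k)%N ->
  ([|| i == 0, i == k, j == 0 | j == (n - k)]%N -> f i j = 1) ->
  \prod_(u : mutable k n) f (mut_i u) (mut_j u) ^+ (mut_coord u == (i, j)) = f i j.
Proof.
move=> ik jn f1; case: (boolP [|| i == 0, i == k, j == 0 | j == (n - k)]%N) => bd.
  rewrite f1 // big1 // => u _; case: eqP => [eu|_]; last by [].
  by have := mut_coordP u; case: eu => -> ->; lia.
have [||u eu] := @mut_coord_ex k n i j; try lia.
rewrite (bigD1 u) // big1 => [|w wu].
  by rewrite eu eqxx; case: eu => -> -> /=; rewrite mulr1.
by rewrite -eu (inj_eq (@mut_coord_inj k n)) (negPf wu).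
Qed.

Lemma flip_mutate tau (v : mutable k n) t :
  let a := mut_i v in let b := mut_j v in
  height_function (flip_height tau) -> tau a b = t -> (t < a)%N ->
  tau a b.+1 = t.+1 -> tau a.+1 b = t.+1 -> tau a b.-1 = t -> tau a.-1 b = t ->
  x a b t != 0 ->
  mutate xpred0 (flip_seed tau) v =
  flip_seed (fun i j => if (i == mut_i v) && (j == mut_j v) then (tau i j).+1 else tau i j).
Proof.
move=> a b htau tab ta tj' ti' tj ti nz.
have vab : mut_coord v = (a, b) by [].
have /andP[va vb] := mut_coordP v; rewrite -/a -/b in va vb.
have hmin : local_min (flip_height tau) (mut_coord v).
  rewrite vab /local_min /flip_height /=; split=> [j|i]; rewrite /adj => /orP[] /eqP E.
  - have -> : j = b.-1 by lia.
    by rewrite tj tab; lia.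
  - by rewrite E tj' tab; lia.
  - have -> : i = a.-1 by lia.
    by rewrite ti tab; lia.
  - by rewrite E ti' tab; lia.
rewrite /mutate /flip_seed; congr Seed; apply/funext => u /=; last first.
  apply/funext => w; rewrite (mutate_height_quiver u w (@mut_coord_inj k n) htau hmin).
  congr nat_of_bool; congr height_arrow; apply/funext => i; apply/funext => j.
  by rewrite /height_raise /flip_height vab /=; case: ifP => // _; lia.
rewrite -(inj_eq (@mut_coord_inj k n)) vab.
rewrite xpair_eqE; case: ifP => // /andP[/eqP -> /eqP ->].
rewrite /exchange /= -/a -/b tab.
pose f i j := x i j (tau i j).
have f1 i' j' : (tau i' j' <= i' <= k)%N -> (j' <= n - k)%N ->
    [|| i' == 0, i' == k, j' == 0 | j' == (n - k)]%N -> f i' j' = 1.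
  by move=> *; apply: x_boundary.
have ab1 : f a b.-1 = \prod_(u : mutable k n) f (mut_i u) (mut_j u) ^+ (mut_coord u == (a, b.-1)).
  by rewrite prod_coord //; [lia | lia | apply: f1; rewrite ?tj; lia].
have ab2 : f a b.+1 = \prod_(u : mutable k n) f (mut_i u) (mut_j u) ^+ (mut_coord u == (a, b.+1)).
  by rewrite prod_coord //; [lia | lia | apply: f1; rewrite ?tj'; lia].
have ab3 : f a.-1 b = \prod_(u : mutable k n) f (mut_i u) (mut_j u) ^+ (mut_coord u == (a.-1, b)).
  by rewrite prod_coord //; [lia | lia | apply: f1; rewrite ?ti; lia].
have ab4 : f a.+1 b = \prod_(u : mutable k n) f (mut_i u) (mut_j u) ^+ (mut_coord u == (a.+1, b)).
  by rewrite prod_coord //; [lia | lia | apply: f1; rewrite ?ti'; lia].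
have -> : \prod_(u : mutable k n) x (mut_i u) (mut_j u) (tau (mut_i u) (mut_j u)) ^+
      height_arrow (flip_height tau) (mut_coord u) (mut_coord v) = f a b.-1 * f a b.+1.
  rewrite ab1 ab2 -big_split /=; apply: eq_bigr => w _; rewrite -exprD; congr (_ ^+ _).
  by rewrite (height_arrow_min_in _ hmin) vab /mut_coord /= !xpair_eqE /adj; lia.
have -> : \prod_(u : mutable k n) x (mut_i u) (mut_j u) (tau (mut_i u) (mut_j u)) ^+
      height_arrow (flip_height tau) (mut_coord v) (mut_coord u) = f a.-1 b * f a.+1 b.
  rewrite ab3 ab4 -big_split /=; apply: eq_bigr => w _; rewrite -exprD; congr (_ ^+ _).
  by rewrite (height_arrow_min_out _ hmin) vab /mut_coord /= !xpair_eqE /adj; lia.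
rewrite /f tj tj' ti ti' -x_exchange; try lia.
by rewrite mulrC mulKf.
Qed.

(** The state in round [t], when the rows [i > i0] and the vertices [(i0, j)]
    with [j0 <= j] have already been treated.  Row [i] is mutated [i] times in
    all, hence the minimum. *)
Definition flip_state (t i0 j0 i j : nat) : nat :=
  minn i (t + ((i0 < i) || (i == i0) && (j0 <= j)))%N.

Lemma flip_state_height t i0 j0 : height_function (flip_height (flip_state t i0 j0)).
Proof. by move=> i j; rewrite /flip_height /flip_state; split; lia. Qed.

Hypothesis x_neq0 : forall s, reachable xpred0 (flip_seed (fun _ _ => 0%N)) s ->
  forall v, seed_var s v != 0.

Local Notation reach tau := (reachable xpred0 (flip_seed (fun _ _ => 0%N)) (flip_seed tau)).

Lemma reach_eq tau tau' :
  (forall i j, (0 < i < k)%N -> (0 < j < n - k)%N -> tau i j = tau' i j) ->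
  reach tau -> reach tau'.
Proof. by move=> /eq_flip_seed ->. Qed.

(** The order of treatment makes [(i0, j0)] a local minimum: [(i0, j0 + 1)]
    and [(i0 + 1, j0)] are one step ahead, [(i0, j0 - 1)] and [(i0 - 1, j0)] are
    not. *)
Lemma reach_step t i0 j0 : (t < i0 < k)%N -> (0 < j0 < n - k)%N ->
  reach (flip_state t i0 j0.+1) -> reach (flip_state t i0 j0).
Proof.
move=> ti jn r; have [||v ev] := @mut_coord_ex k n i0 j0; try lia.
have nz := x_neq0 r v; case: (ev) => vi vj; rewrite /= vi vj in nz.
have -> : flip_seed (flip_state t i0 j0) = mutate xpred0 (flip_seed (flip_state t i0 j0.+1)) v.
  rewrite (@flip_mutate _ _ t) /= ?vi ?vj.
  - by apply: eq_flip_seed => i j ik jk; case: ifP; rewrite /flip_state; lia.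
  - exact: flip_state_height.
  all: try by rewrite /flip_state; lia.
  have eq_t : flip_state t i0 j0.+1 i0 j0 = t by rewrite /flip_state; lia.
  by rewrite eq_t in nz.
exact: reachable_mutate.
Qed.

Lemma reach_row t i0 : (t < i0 < k)%N ->
  reach (flip_state t i0 (n - k)) -> reach (flip_state t i0.-1 (n - k)).
Proof.
move=> ti r; suff rm m : (m < n - k)%N -> reach (flip_state t i0 (n - k - m)).
  have [n0 | n0] := posnP (n - k); first by apply: reach_eq r => i j; lia.
  apply: (@reach_eq (flip_state t i0 (n - k - (n - k).-1))); last by apply: rm; lia.
  by move=> i j ik jn; rewrite /flip_state; lia.
elim: m => [|m IHm] mn; first by rewrite subn0.
apply: reach_step; try lia.
have -> : (n - k - m.+1).+1 = (n - k - m)%N by lia.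
by apply: IHm; lia.
Qed.

Lemma reach_round t : (t.+1 < k)%N ->
  reach (flip_state t k.-1 (n - k)) -> reach (flip_state t.+1 k.-1 (n - k)).
Proof.
move=> tk r; suff rm m : (m <= k.-1 - t)%N -> reach (flip_state t (k.-1 - m) (n - k)).
  apply: reach_eq (rm (k.-1 - t)%N (leqnn _)).
  by move=> i j ik jn; rewrite /flip_state; lia.
elim: m => [|m IHm] mt; first by rewrite subn0.
by rewrite subnS; apply: reach_row; [lia | apply: IHm; lia].
Qed.

Lemma reach_final : reach (fun i _ => i).
Proof.
have r0 tau : (forall i j, (0 < i < k)%N -> (0 < j < n - k)%N -> tau i j = 0%N) -> reach tau.
  by move=> tau0; apply: reach_eq (reachable_init _ _) => i j ik jn; rewrite tau0.
suff rt t : (t < k)%N -> reach (flip_state t k.-1 (n - k)).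
  have [k0 | k0] := posnP k; first by apply: r0 => i j; lia.
  apply: (@reach_eq (flip_state k.-1 k.-1 (n - k))); last by apply: rt; lia.
  by move=> i j ik jn; rewrite /flip_state; lia.
elim: t => [|t IHt] tk; last by apply: reach_round => //; apply: IHt; lia.
by apply: r0 => i j ik jn; rewrite /flip_state; lia.
Qed.

End FlipPath.

(** * Determinants of sequences of columns *)

Section Columns.
Variable A : comNzRingType.

Definition cols_mx k (F : nat -> 'cV[A]_k) : 'M[A]_k := \matrix_(r, s) F s r 0.

Definition detc k (F : nat -> 'cV[A]_k) : A := \det (cols_mx F).

Definition insert (T : Type) (p : nat) (x : T) (F : nat -> T) (r : nat) : T :=
  if (r < p)%N then F r else if r == p then x else F r.-1.

Lemma eq_detc k (F F' : nat -> 'cV[A]_k) :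
  (forall s, (s < k)%N -> F s = F' s) -> detc F = detc F'.
Proof.
by move=> eqF; congr (\det _); apply/matrixP => r s; rewrite !mxE eqF.
Qed.

Lemma detc_alternate k (F : nat -> 'cV[A]_k) s t :
  (s < k)%N -> (t < k)%N -> s != t -> F s = F t -> detc F = 0.
Proof.
move=> sk tk st eqF; rewrite /detc -det_tr.
apply: (@determinant_alternate _ _ _ (Ordinal sk) (Ordinal tk)) => // r.
by rewrite !mxE /= eqF.
Qed.

Lemma detc_scale k (F : nat -> 'cV[A]_k) (e : nat -> A) :
  detc (fun s => e s *: F s) = (\prod_(s < k) e s) * detc F.
Proof.
transitivity (\det (cols_mx F *m diag_mx (\row_s e s))).
  congr (\det _); apply/matrixP => r s.
  by rewrite mul_mx_diag !mxE mulrC.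
rewrite det_mulmx det_diag mulrC; congr (_ * _).
by apply: eq_bigr => s _; rewrite mxE.
Qed.

(** The cofactors of the inserted column only involve the other columns, in the
    same order whatever [p] is. *)
Lemma detc_insert k (F : nat -> 'cV[A]_k.+1) x p : (p <= k)%N ->
  detc (insert p x F) = (-1) ^+ p * detc (insert 0 x F).
Proof.
move=> pk; pose q : 'I_k.+1 := inord p.
have qE : q = p :> nat by rewrite inordK.
rewrite /detc (expand_det_col _ q) (expand_det_col _ ord0) big_distrr /=.
apply: eq_bigr => i _; rewrite !mxE /insert qE ltnn !eqxx /=.
rewrite [RHS]mulrCA; congr (_ * _).
rewrite /cofactor qE addn0 mulrA -exprD addnC; congr (_ * \det _).
apply/matrixP => r s; rewrite !mxE !lift0 /= qE /bump.
case: (leqP p s) => [ps | sp]; rewrite ?add1n ?add0n ?sp //=.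
have -> : (s.+1 < p)%N = false by lia.
by have -> : (s.+1 == p) = false by lia.
Qed.

Lemma detc_update k (F : nat -> 'cV[A]_k) (a : 'I_k) x :
  detc (fun s => if s == a then x else F s) = (\adj (cols_mx F) *m x) a 0.
Proof.
rewrite /detc (expand_det_col _ a) mxE; apply: eq_bigr => i _.
rewrite !mxE eqxx mulrC; congr (_ * _); rewrite /cofactor; congr (_ * \det _).
apply/matrixP => r s; rewrite !mxE -[_ == _ :> nat]/(lift a s == a).
by rewrite eq_sym (negPf (neq_lift a s)).
Qed.

Lemma detc_swap k (x y : 'cV[A]_k.+2) (S : nat -> 'cV[A]_k.+2) :
  detc (insert 0 x (insert 0 y S)) = - detc (insert 0 y (insert 0 x S)).
Proof.
by rewrite -mulN1r -(expr1 (-1)) -detc_insert //; apply: eq_detc => -[|[|s]].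
Qed.

Lemma detc_insert2 k (x y : 'cV[A]_k.+2) (S : nat -> 'cV[A]_k.+2) a b :
  (a <= k.+1)%N -> (b <= k)%N ->
  detc (insert a x (insert b y S)) =
  (-1) ^+ (a + b) * detc (insert 0 x (insert 0 y S)).
Proof.
move=> ak bk; rewrite detc_insert // exprD -mulrA; congr (_ * _).
transitivity (detc (insert b.+1 y (insert 0 x S))).
  by apply: eq_detc => -[|[|s]] _ //; case: b {bk}.
by rewrite detc_insert // exprS mulN1r mulNr -mulrN -detc_swap.
Qed.

(** Cramer's rule: with [M] the matrix of [x1], [x2] and [S], expand
    [d x1 x2 *: x3 = M *m (\adj M *m x3)] along the columns of [M] and substitute
    it into [d _ x4].  The columns of [S] give 0, and what remains is
    [d x1 x2 * d x3 x4 = d x1 x4 * d x3 x2 + d x2 x4 * d x1 x3]. *)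
Lemma detc_plucker3 k (x1 x2 x3 x4 : 'cV[A]_k.+2) (S : nat -> 'cV[A]_k.+2) :
  let d x y := detc (insert 0 x (insert 0 y S)) in
  d x1 x3 * d x2 x4 = d x1 x2 * d x3 x4 + d x1 x4 * d x2 x3.
Proof.
move=> d.
pose M := cols_mx (insert 0 x1 (insert 0 x2 S)).
pose M4 := cols_mx (insert 0 x1 (insert 0 x4 S)).
have adj0 (F : nat -> 'cV_k.+2) z y : (forall s, F s.+1 = insert 0 y S s) ->
    (\adj (cols_mx F) *m z) ord0 0 = d z y.
  by move=> eqF; rewrite -detc_update; apply: eq_detc => -[|s] _ //=; rewrite eqF.
have adj1 z : (\adj M *m z) (lift ord0 ord0) 0 = d x1 z.
  by rewrite -detc_update; apply: eq_detc => -[|[|s]].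
have key : d x1 x2 * d x3 x4 = (\adj M4 *m M *m (\adj M *m x3)) ord0 0.
  rewrite -[_ *m _ *m _]mulmxA (mulmxA M) mul_mx_adj mul_scalar_mx -scalemxAr mxE.
  by rewrite (adj0 _ _ x4).
have M4M (m : 'I_k.+2) : (\adj M4 *m M) ord0 m = d (col m M) x4.
  by rewrite -(adj0 (insert 0 x1 (insert 0 x4 S))) // mxE [RHS]mxE; apply: eq_bigr => i _; rewrite [col m M i 0]mxE.
rewrite key mxE big_ord_recl big_ord_recl big1 => [|m _].
  rewrite addr0 !M4M adj1 (adj0 _ _ x2) // (detc_swap x3 x2 S : d x3 x2 = - d x2 x3).
  have -> : col ord0 M = x1 by apply/colP => r; rewrite !mxE.
  have -> : col (lift ord0 ord0) M = x2 by apply/colP => r; rewrite !mxE.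
  by rewrite mulrN addrAC addNr add0r mulrC.
rewrite M4M; have -> : col (lift ord0 (lift ord0 m)) M = S m.
  by apply/colP => r; rewrite !mxE !lift0.
rewrite /d (@detc_alternate _ _ 0 m.+2) ?mul0r //.
by rewrite !ltnS.
Qed.

Lemma detc_insert0Z k (F : nat -> 'cV[A]_k.+1) a x :
  detc (insert 0 (a *: x) F) = a * detc (insert 0 x F).
Proof.
pose e s := if s == 0%N then a else 1.
have -> : a = \prod_(s < k.+1) e s by rewrite big_ord_recl big1 ?mulr1.
rewrite -detc_scale; apply: eq_detc => -[|s] _ /=; last by rewrite /insert /e scale1r.
by rewrite big_ord_recl big1 ?mulr1.
Qed.

(** Moving one column past [k - 1] others costs the sign [(-1) ^+ k.-1], which the
    quasi-periodicity of the columns compensates. *)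
Lemma detc_rotate1 k (F : nat -> 'cV[A]_k) : F k = (-1) ^+ k.-1 *: F 0%N ->
  detc (fun s => F s.+1) = detc F.
Proof.
case: k F => [|k] F Fk; first by apply: eq_detc.
transitivity (detc (insert k ((-1) ^+ k *: F 0%N) (fun s => F s.+1))).
  apply: eq_detc => s; rewrite ltnS leq_eqVlt /insert => /orP[/eqP -> | ->] //.
  by rewrite ltnn eqxx.
rewrite detc_insert // detc_insert0Z mulrA -exprD addnn -mul2n exprM sqrrN !expr1n mul1r.
by apply: eq_detc => -[|s].
Qed.

End Columns.

(** * Minors and quasi-periodic columns *)

Ltac if_lia := repeat (case: ifP => ?); lia.

Section Minors.
Variables (A : comNzRingType) (k n : nat) (p : 'M[A]_(k, n)).

Definition nat_col (m : nat) : 'cV[A]_k := if insub m is Some c then col c p else 0.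

Lemma nat_colE (c : 'I_n) : nat_col c = col c p.
Proof. by rewrite /nat_col valK. Qed.

Lemma minor_detc (I : {set 'I_n}) : #|I| = k ->
  minor p I = detc (fun s => nat_col (nth 0%N [seq val c | c <- enum I] s)).
Proof.
move=> cardI; congr (\det _); apply/matrixP => r s; rewrite !mxE.
have sI : (s < size (enum I))%N by rewrite -cardE cardI.
case: (enum I) sI => // c0 e sI.
by rewrite !(nth_map c0) // nat_colE mxE.
Qed.

Lemma minor_increasing (f : nat -> nat) (I : {set 'I_n}) :
  (forall s t, (s < t < k)%N -> (f s < f t)%N) ->
  (forall s, (s < k)%N -> (f s < n)%N) ->
  (forall c : 'I_n, (c \in I) = has (fun s => f s == c) (iota 0 k)) ->
  minor p I = detc (fun s => nat_col (f s)).
Proof.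
move=> f_inc f_lt memI.
have eqI : [seq val c | c <- enum I] = [seq f s | s <- iota 0 k].
  apply: (irr_sorted_eq ltn_trans ltnn).
  - rewrite sorted_map; apply: sorted_filter; first by move=> x y z; apply: ltn_trans.
    by rewrite -sorted_map -enumT val_enum_ord iota_ltn_sorted.
  - rewrite sorted_map; apply: (sub_in_sorted (P := gtn k)) (iota_ltn_sorted 0 k).
      by move=> s t _ tk st; apply: f_inc; apply/andP.
    by apply/allP => s; rewrite mem_iota.
  - move=> m; apply/mapP/mapP => [[c] | [s]].
      rewrite mem_enum memI => /hasP[s sk /eqP fs] ->; by exists s.
    rewrite mem_iota => /= sk ->; exists (Ordinal (f_lt s sk)) => //.
    by rewrite mem_enum memI; apply/hasP; exists s => //; rewrite mem_iota.
rewrite minor_detc; last by rewrite cardE -(size_map val) eqI size_map size_iota.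
apply: eq_detc => s sk; rewrite eqI (nth_map 0%N) ?size_iota //.
by rewrite nth_iota.
Qed.

(** Column [c] has number [n + c] in the quasi-periodic sequence; the shift by [n]
    leaves room to walk backwards within the natural numbers. *)
Definition ext_col (m : nat) : 'cV[A]_k := (-1) ^+ (k.-1 * (m %/ n).+1) *: nat_col (m %% n).

Hypotheses (k_gt0 : (0 < k)%N) (k_le_n : (k <= n)%N).

Lemma ext_col_shift m : ext_col (m + n) = (-1) ^+ k.-1 *: ext_col m.
Proof.
rewrite /ext_col modnDr divnDr ?dvdnn // divnn; have -> : (0 < n)%N by lia.
by rewrite addn1 scalerA -exprD -mulnS.
Qed.

Lemma ext_col_in m : (m < n)%N -> ext_col (n + m) = nat_col m.
Proof.
move=> mn; rewrite addnC ext_col_shift /ext_col modn_small // divn_small //.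
by rewrite muln1 scalerA -exprD addnn -mul2n exprM sqrrN !expr1n scale1r.
Qed.

Lemma ext_col_before m : (m < n)%N -> ext_col m = (-1) ^+ k.-1 *: nat_col m.
Proof. by move=> mn; rewrite /ext_col modn_small // divn_small // muln1. Qed.

Lemma detc_rotate (f : nat -> nat) t : (forall r, f (r + k)%N = (f r + n)%N) ->
  detc (fun s => ext_col (f (s + t)%N)) = detc (fun s => ext_col (f s)).
Proof.
move=> f_per; elim: t => [|t <-]; first by apply: eq_detc => s _; rewrite addn0.
rewrite -(detc_rotate1 (F := fun s => ext_col (f (s + t)%N))).
  by apply: eq_detc => s _; rewrite addnS.
by rewrite add0n addnC f_per ext_col_shift.
Qed.

Lemma iter_ord_pred (c : 'I_n) m : (m <= n)%N ->
  iter m (@ord_pred n) c = (if m <= c then c - m else c + n - m)%N :> nat.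
Proof.
elim: m => [|m IHm] mn; first by rewrite subn0.
have := ltn_ord c; have := ltn_ord (iter m (@ord_pred n) c).
rewrite iterS /= IHm; last by lia.
case: (leqP m.+1 c) => mc lt1 ltc.
  rewrite (ltnW mc); have -> : (c - m + n).-1 = (c - m.+1 + n)%N by lia.
  by rewrite modnDr modn_small //; lia.
case: (leqP m c) => mc' in lt1 *.
  have -> : (c - m + n).-1 = (c + n - m.+1)%N by lia.
  by rewrite modn_small //; lia.
have -> : (c + n - m + n).-1 = (c + n - m.+1 + n)%N by lia.
by rewrite modnDr modn_small //; lia.
Qed.

Lemma mem_coef_set (c d : 'I_n) : (d \in coef_set k c) =
  [exists m : 'I_k, (d == (if m <= c then c - m else c + n - m) :> nat)%N].
Proof.
apply/imsetP/existsP => [[m _ ->] | [m /eqP dm]]; exists m => //.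
  by rewrite iter_ord_pred // ltnW // (leq_trans (ltn_ord m)).
by apply: val_inj; rewrite /= iter_ord_pred // ltnW // (leq_trans (ltn_ord m)).
Qed.

(** The increasing enumeration of the cyclic interval of length [k] ending at [c];
    the interval wraps around when [c.+1 < k]. *)
Definition wrap (c s : nat) : nat :=
  (if k <= c.+1 then s + c.+1 - k else if s <= c then s else s + n - k)%N.

Lemma coef_sorted (c : 'I_n) : minor p (coef_set k c) = detc (fun s => ext_col (n + wrap c s)).
Proof.
have cn := ltn_ord c.
have wrap_lt s : (s < k)%N -> (wrap c s < n)%N by rewrite /wrap; if_lia.
rewrite (minor_increasing (f := wrap c)) //.
- by apply: eq_detc => s sk; rewrite ext_col_in // wrap_lt.
- by move=> s t; rewrite /wrap; if_lia.
- move=> d; have dn := ltn_ord d; rewrite mem_coef_set; apply/existsP/hasP => [[m /eqP dm] | [s]].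
    have mk := ltn_ord m.
    have [kc|kc] := leqP k c.+1; [exists (k.-1 - m)%N | move: dm; case: (leqP m c) => mc dm;
        [exists (c - m)%N | exists (c + k - m)%N]]; rewrite ?mem_iota; try lia.
    - by rewrite /wrap kc; apply/eqP; move: dm; if_lia.
    - by rewrite /wrap leqNgt kc /=; apply/eqP; if_lia.
    - by rewrite /wrap leqNgt kc /=; apply/eqP; if_lia.
  rewrite mem_iota /= add0n => sk; rewrite /wrap.
  have mem m (mk : (m < k)%N) : d = (if m <= c then c - m else c + n - m)%N :> nat ->
      exists m : 'I_k, d == (if m <= c then c - m else c + n - m)%N :> nat.
    by move=> dE; exists (Ordinal mk); rewrite /= -dE.
  case: (leqP k c.+1) => kc.
    have mk : (k.-1 - s < k)%N by lia.
    by move=> /eqP dE; apply: (mem _ mk); rewrite -dE; if_lia.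
  case: (leqP s c) => sc /eqP dE.
    have mk : (c - s < k)%N by lia.
    by apply: (mem _ mk); rewrite -dE; if_lia.
  have mk : (c + k - s < k)%N by lia.
  by apply: (mem _ mk); rewrite -dE; if_lia.
Qed.

(** With quasi-periodic columns a coefficient is the determinant of [k]
    consecutive columns even when its interval wraps around: it differs from the
    sorted minor by [k.-1 - c] rotations. *)
Lemma coef_window (c : 'I_n) :
  minor p (coef_set k c) = detc (fun s => ext_col (n + c - k.-1 + s)).
Proof.
have cn := ltn_ord c; rewrite coef_sorted.
case: (leqP k c.+1) => kc.
  by apply: eq_detc => s sk; congr ext_col; rewrite /wrap kc; lia.
(* The periodic continuation of the window; [k.-1 - c] rotations sort it. *)
pose g r := (n + c - k.-1 + r %% k + n * (r %/ k))%N.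
transitivity (detc (fun s => ext_col (g (s + (k.-1 - c))%N))).
  apply: eq_detc => s sk; congr ext_col; rewrite /wrap leqNgt kc /= /g.
  case: (leqP s c) => sc.
    by rewrite modn_small ?divn_small; lia.
  have -> : (s + (k.-1 - c) = s - c.+1 + k)%N by lia.
  by rewrite modnDr divnDr ?dvdnn // divnn k_gt0 modn_small ?divn_small; lia.
rewrite detc_rotate => [|r].
  by apply: eq_detc => s sk; rewrite /g modn_small // divn_small // muln0 addn0.
by rewrite /g modnDr divnDr ?dvdnn // divnn k_gt0 addn1 mulnS; lia.
Qed.

(** * The twisted columns *)

Definition twisted_col (c : nat) : 'cV[A]_k := cross (fun m => ext_col (n + c - k.-1 + m)).

Lemma crossZ (e : nat -> A) (v : nat -> 'cV[A]_k) :
  cross (fun m => e m *: v m) = (\prod_(m < k.-1) e m) *: cross v.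
Proof.
apply/colP => r; rewrite !mxE.
pose u := delta_mx r 0 : 'cV[A]_k.
pose e1 m := if (m < k.-1)%N then e m else 1.
transitivity (detc (fun m => e1 m *: (if (m < k.-1)%N then v m else u))).
  congr (\det _); apply/matrixP => i j; rewrite !mxE /e1.
  by case: ifP => _; rewrite !mxE ?mul1r.
rewrite detc_scale; congr (_ * _).
have kE : k = k.-1.+1 by lia.
rewrite [in LHS]kE big_ord_recr /= /e1 ltnn mulr1.
by apply: eq_bigr => i _; rewrite ltn_ord.
Qed.

(** The sign [twist_sign] is the product of the quasi-periodicity signs of the
    columns numbered before the first one: there are [k.-1 - c] of them, each carrying
    [(-1) ^+ k.-1], and [(k.-1 - c) * k.-1] has the parity of
    [c.+1 * (k - c.+1)]. *)
Lemma twist_col (c : 'I_n) : col c (twist_mx p) = twisted_col c.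
Proof.
have cn := ltn_ord c.
pose e m : A := if (k.-1 - m <= c)%N then 1 else (-1) ^+ k.-1.
pose v m := col (iter (k.-1 - m) (@ord_pred n) c) p.
have eq_cross (v1 v2 : nat -> 'cV[A]_k) :
    (forall m, (m < k.-1)%N -> v1 m = v2 m) -> cross v1 = cross v2.
  move=> eqv; apply/colP => r; rewrite !mxE; congr (\det _).
  by apply/matrixP => i j; rewrite !mxE; case: ifP => // /eqv ->.
have -> : twisted_col c = cross (fun m => e m *: v m).
  apply: eq_cross => m mk; rewrite /e /v -nat_colE iter_ord_pred; last by lia.
  have := ext_col_before; have := ext_col_in.
  case: leqP => mc q_in q_before.
    by rewrite scale1r -q_in; [congr ext_col | ]; lia.
  have -> : (n + c - k.-1 + m = c + n - (k.-1 - m))%N by lia.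
  by rewrite q_before //; lia.
rewrite crossZ; apply/colP => r; rewrite [LHS]mxE [LHS]mxE [RHS]mxE; congr (_ * cross _ r 0).
rewrite /twist_sign /e; case: (leqP c.+1 k.-1) => ck.
  transitivity (\prod_(m < k.-1 | (m < k.-1 - c)%N) (-1) ^+ k.-1 : A).
    rewrite -(big_ord_widen _ (fun=> (-1) ^+ k.-1)); last by lia.
    rewrite prodr_const card_ord -exprM.
    rewrite -[LHS]signr_odd -[RHS]signr_odd; congr (_ ^+ _); congr (nat_of_bool _).
    by rewrite !oddM; lia.
  rewrite big_mkcond; apply: eq_bigr => m _; have := ltn_ord m.
  by case: ifP => ? ?; case: ifP => //; lia.
by rewrite big1 // => m _; case: ifP => //; lia.
Qed.

(** The scalar products of twisted columns with columns, see [gramE]. *)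
Definition gram (c d : nat) : A :=
  detc (fun s => if (s < k.-1)%N then ext_col (n + c - k.-1 + s) else ext_col d).

Lemma gramE c d : ((twisted_col c)^T *m ext_col d) 0 0 = gram c d.
Proof. by rewrite crossP. Qed.

Lemma gram_eq0 c d : (n + c < d + k)%N -> (d < n + c)%N -> gram c d = 0.
Proof.
move=> cd dc; apply: (@detc_alternate _ _ _ (d - (n + c - k.-1)) k.-1); try lia.
have -> : (d - (n + c - k.-1) < k.-1)%N by lia.
by rewrite ltnn; congr ext_col; lia.
Qed.

Lemma gram_shift c d : gram c (d + n) = (-1) ^+ k.-1 * gram c d.
Proof.
rewrite -!gramE ext_col_shift -scalemxAr mxE //.
Qed.

Lemma gram_diag (c : 'I_n) : gram c (n + c) = minor p (coef_set k c).
Proof.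
rewrite coef_window; apply: eq_detc => s sk.
have cn := ltn_ord c.
by case: ifP => // sk'; congr ext_col; lia.
Qed.

Lemma det_gram (f g : nat -> nat) :
  detc (fun s => twisted_col (f s)) * detc (fun s => ext_col (g s)) =
  \det (\matrix_(r < k, s < k) gram (f r) (g s)).
Proof.
rewrite /detc -[\det (cols_mx (fun s => twisted_col _))]det_tr -det_mulmx; congr (\det _).
apply/matrixP => r s; rewrite [RHS]mxE -gramE [LHS]mxE [RHS]mxE.
by apply: eq_bigr => i _; rewrite !mxE.
Qed.

Lemma wrap_lt (c : 'I_n) s : (s < k)%N -> (wrap c s < n)%N.
Proof. by have := ltn_ord c; rewrite /wrap; if_lia. Qed.

Lemma wrap_inc (c : 'I_n) s t : (s < t < k)%N -> (wrap c s < wrap c t)%N.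
Proof. by have := ltn_ord c; rewrite /wrap; if_lia. Qed.

Lemma coef_nat_col (c : 'I_n) : minor p (coef_set k c) = detc (fun s => nat_col (wrap c s)).
Proof. by rewrite coef_sorted; apply: eq_detc => s sk; rewrite ext_col_in // wrap_lt. Qed.

(** Pair the twisted columns with the window ending at the first of them.  The
    first row of the product has a single nonzero entry, the coefficient
    [coef_set k c0], which is also the determinant of the window. *)
Lemma detc_twisted_col_cofactor (f : nat -> nat) (c0 : 'I_n) : f 0%N = c0 ->
  exists r s, detc (fun s => twisted_col (f s)) * minor p (coef_set k c0) =
  cofactor (\matrix_(r < k, s < k) gram (f r) (n + c0 - k.-1 + s)) r s *
  minor p (coef_set k c0).
Proof.
move=> f0; have last_lt : (k.-1 < k)%N by lia.
have cn := ltn_ord c0.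
exists (Ordinal k_gt0), (Ordinal last_lt).
rewrite {1}coef_window det_gram (expand_det_row _ (Ordinal k_gt0)).
rewrite (bigD1 (Ordinal last_lt)) //= big1 ?addr0 => [|s ne_s].
  by rewrite mulrC mxE -gram_diag f0; congr (_ * gram _ _) => /=; lia.
have : (s < k.-1)%N by have := ltn_ord s; move: ne_s; rewrite -val_eqE /=; lia.
by move=> sk; rewrite mxE gram_eq0 ?mul0r //= f0; lia.
Qed.

End Minors.

(** * Block triangular determinants *)

Section BlockDet.
Variable A : comNzRingType.

Lemma det_upper m (B : nat -> nat -> A) :
  (forall r s, (s < r < m)%N -> B r s = 0) ->
  \det (\matrix_(r < m, s < m) B r s) = \prod_(r < m) B r r.
Proof.
move=> B0; rewrite -det_tr det_trig; first by apply: eq_bigr => r _; rewrite !mxE.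
by apply/is_trig_mxP => r s rs; rewrite !mxE B0 // rs /=.
Qed.

Lemma det_lower_block m a (B : nat -> nat -> A) : (a <= m)%N ->
  (forall r s, (r < a)%N -> (a <= s < m)%N -> B r s = 0) ->
  \det (\matrix_(r < m, s < m) B r s) =
  \det (\matrix_(r < a, s < a) B r s) *
  \det (\matrix_(r < m - a, s < m - a) B (a + r)%N (a + s)%N).
Proof.
move=> am; move: (m - a)%N (subnKC am) => b <- B0.
rewrite -[X in \det X = _]submxK.
have -> : ursubmx (\matrix_(r < a + b, s < a + b) B r s) = 0.
  apply/matrixP => r s; rewrite !mxE /=.
  by apply: B0; rewrite ?leq_addr ?ltn_add2l /= ltn_ord.
rewrite det_lblock; congr (_ * _).
  by congr (\det _); apply/matrixP => r s; rewrite !mxE.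
by congr (\det _); apply/matrixP => r s; rewrite !mxE.
Qed.

Lemma det_matrixC m (B : nat -> nat -> A) :
  \det (\matrix_(r < m, s < m) B r s) = \det (\matrix_(r < m, s < m) B s r).
Proof. by rewrite -det_tr; congr (\det _); apply/matrixP => r s; rewrite !mxE. Qed.

Lemma det_upper_block m a (B : nat -> nat -> A) : (a <= m)%N ->
  (forall r s, (a <= r < m)%N -> (s < a)%N -> B r s = 0) ->
  \det (\matrix_(r < m, s < m) B r s) =
  \det (\matrix_(r < a, s < a) B r s) *
  \det (\matrix_(r < m - a, s < m - a) B (a + r)%N (a + s)%N).
Proof.
move=> am B0; rewrite det_matrixC (det_lower_block (B := fun r s => B s r) am).
  by rewrite -det_matrixC; congr (_ * _); rewrite (det_matrixC _ (fun r s => B (a + s)%N (a + r)%N)).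
by move=> r s ra sa; apply: B0.
Qed.
End BlockDet.

(** * Staircase minors and their twists *)

(** The increasing sequence which enumerates [{0, ..., a - 1}], the interval of
    length [b - a] starting at [a + j], and the last [k - b] of [n] columns. *)
Definition stair (k n a b j s : nat) : nat :=
  (if s < a then s else if s < b then s + j else s + (n - k))%N.

Section TwistStair.
Variables (A : comNzRingType) (k n : nat) (p : 'M[A]_(k, n)).
Hypotheses (k_gt0 : (0 < k)%N) (k_lt_n : (k < n)%N).

Local Notation q := (ext_col p).
Local Notation w := (twisted_col p).
Let k_le_n : (k <= n)%N := ltnW k_lt_n.

Definition stair_plucker a b j := detc (fun s => q (n + stair k n a b j s)%N).
Definition stair_twist a b j := detc (fun s => w (stair k n a b j s)%N).
Definition gram_coef (c : nat) : A := gram p c (n + c).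

Lemma gram_coefE c (cn : (c < n)%N) : gram_coef c = minor p (coef_set k (Ordinal cn)).
Proof. by rewrite -gram_diag. Qed.

Lemma stair_twist_interval j : (j <= n - k)%N ->
  stair_twist 0 k j * gram_coef (j + k.-1) = \prod_(r < k) gram_coef (j + r).
Proof.
move=> jn.
have -> : gram_coef (j + k.-1) = detc (fun s => q (n + (j + s))%N).
  rewrite /gram_coef /gram; apply: eq_detc => s sk.
  by case: ifP => // sk'; congr (ext_col _ _); lia.
rewrite det_gram // (@det_upper _ _ (fun r s => gram p (stair k n 0 k j r) (n + (j + s)))).
  apply: eq_bigr => r _; rewrite /gram_coef /stair ltn_ord /=; congr (gram _ _ _); lia.
move=> r s rs; rewrite /stair /=; have -> : (r < k)%N by lia.
by apply: gram_eq0 => //; lia.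
Qed.

Definition cross_gram i j : A :=
  \det (\matrix_(r < k - i, s < k - i) gram p (i + r + j) (n + (i + s + (n - k)))).

(** Pair the twisted columns of [stair i k j] with the columns of the wrapped
    interval [stair i i j].  For the first [i] rows the columns of the last
    block lie, up to a shift by [n], within the window where [gram] vanishes. *)
Lemma stair_twist_lower i j : (i <= k)%N -> (j <= n - k)%N ->
  stair_twist i k j * stair_plucker i i j = (\prod_(r < i) gram_coef r) * cross_gram i j.
Proof.
move=> ik jn; rewrite /stair_twist /stair_plucker det_gram //.
rewrite (@det_lower_block _ _ i (fun r s => gram p (stair k n i k j r) (n + stair k n i i j s))) //.
  congr (_ * _).
    rewrite (@det_upper _ _ (fun r s => gram p (stair k n i k j r) (n + stair k n i i j s))).
      by apply: eq_bigr => r _; rewrite /stair ltn_ord.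
    move=> r s rs; rewrite /stair; have [-> ->] : (s < i)%N /\ (r < i)%N by lia.
    by apply: gram_eq0 => //; lia.
  congr (\det _); apply/matrixP => r s; rewrite !mxE /stair.
  have rk := ltn_ord r; have sk := ltn_ord s.
  have -> : (i + r < i)%N = false by lia.
  have -> : (i + s < i)%N = false by lia.
  by have -> : (i + r < k)%N by lia.
move=> r s ri is_; rewrite /stair ri; have -> : (s < i)%N = false by lia.
have -> : (n + (s + (n - k)) = (s + (n - k)) + n)%N by lia.
by rewrite gram_shift // gram_eq0 ?mulr0 //; lia.
Qed.

(** The same unknown block [cross_gram i j] arises from a twisted interval: the
    rows [r >= i] agree with those of [stair i k j], and so do the columns
    [s >= i].  Now the lower left block vanishes. *)
Lemma stair_twist_upper i j : (i <= k)%N -> (j <= n - k)%N ->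
  stair_twist 0 k j * stair_plucker 0 i j = (\prod_(r < i) gram_coef (j + r)) * cross_gram i j.
Proof.
move=> ik jn; rewrite /stair_twist /stair_plucker det_gram //.
rewrite (@det_upper_block _ _ i (fun r s => gram p (stair k n 0 k j r) (n + stair k n 0 i j s))) //.
  congr (_ * _).
    rewrite (@det_upper _ _ (fun r s => gram p (stair k n 0 k j r) (n + stair k n 0 i j s))).
      apply: eq_bigr => r _; rewrite /stair ltn_ord /= /gram_coef.
      have rk := ltn_ord r; have -> : (r < k)%N by lia.
      by rewrite addnC.
    move=> r s rs; rewrite /stair /=; have [-> ->] : (s < i)%N /\ (r < k)%N by lia.
    by apply: gram_eq0 => //; lia.
  congr (\det _); apply/matrixP => r s; rewrite !mxE /stair /=.
  have rk := ltn_ord r; have sk := ltn_ord s.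
  have -> : (i + s < i)%N = false by lia.
  by have -> : (i + r < k)%N by lia.
move=> r s ri is_; rewrite /stair /= is_; have -> : (r < k)%N by lia.
by apply: gram_eq0 => //; lia.
Qed.

End TwistStair.

Definition stair_minor (A : comNzRingType) k n (u : nat -> 'cV[A]_k) a b j : A :=
  detc (fun s => u (stair k n a b j s)).

(** The three-term relation for the columns [x1 < x2 < x3 < x4] inserted into the
    common part [S] of the six staircases.  The signs of the insertions cancel,
    because [x1], [x2] go to one place of [S] and [x3], [x4] to another. *)
Lemma stair_exchange (A : comNzRingType) k n (u : nat -> 'cV[A]_k) a b j : (0 < a < b)%N -> (b <= k)%N -> (0 < j)%N ->
  stair_minor n u a b j * stair_minor n u a.-1 b.-1 j =
  stair_minor n u a b j.-1 * stair_minor n u a.-1 b.-1 j.+1 +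
  stair_minor n u a b.-1 j * stair_minor n u a.-1 b j.
Proof.
move=> ab bk j0; rewrite /stair_minor.
have kE : k = (k - 2).+2 by lia.
move: (k - 2)%N kE u bk => m -> u bk; set K := m.+2.
pose S r := (if r < a.-1 then r else if r < b - 2 then r + 1 + j else r + 2 + (n - K))%N.
pose x1 := a.-1; pose x2 := (a + j).-1.
pose x3 := (b + j).-1; pose x4 := (b.-1 + (n - K))%N.
pose d x y := detc (insert 0 (u x) (insert 0 (u y) (fun r => u (S r)))).
pose e : A := (-1) ^+ (a.-1 + (b - 2)).
have ins c l y z F : (c <= m.+1)%N -> (l <= m)%N ->
    (forall s, (s < K)%N -> F s = insert c y (insert l z S) s) ->
    detc (fun s => u (F s)) = (-1) ^+ (c + l) * d y z.
  move=> cm lm eqF; rewrite -detc_insert2 //; apply: eq_detc => s sK.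
  by rewrite eqF // /insert; do ?case: ifP.
have e2 c : (-1) ^+ (c + c) = 1 :> A by rewrite addnn -mul2n exprM sqrrN !expr1n.
have ee y z : e * y * (e * z) = y * z by rewrite mulrACA -exprD e2 mul1r.
rewrite (ins a.-1 (b - 2)%N x1 x3 (stair K n a b j));
  [ | lia | lia | by move=> s sK; rewrite /insert /stair /S /x1 /x3; if_lia].
rewrite (ins a.-1 (b - 2)%N x2 x4 (stair K n a.-1 b.-1 j));
  [ | lia | lia | by move=> s sK; rewrite /insert /stair /S /x2 /x4; if_lia].
rewrite (ins a.-1 a.-1 x1 x2 (stair K n a b j.-1));
  [ | lia | lia | by move=> s sK; rewrite /insert /stair /S /x1 /x2; if_lia].
rewrite (ins (b - 2)%N (b - 2)%N x3 x4 (stair K n a.-1 b.-1 j.+1));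
  [ | lia | lia | by move=> s sK; rewrite /insert /stair /S /x3 /x4; if_lia].
rewrite (ins a.-1 (b - 2)%N x1 x4 (stair K n a b.-1 j));
  [ | lia | lia | by move=> s sK; rewrite /insert /stair /S /x1 /x4; if_lia].
rewrite (ins a.-1 (b - 2)%N x2 x3 (stair K n a.-1 b j));
  [ | lia | lia | by move=> s sK; rewrite /insert /stair /S /x2 /x3; if_lia].
rewrite -/e !e2 !mul1r !ee.
exact: detc_plucker3.
Qed.

(** A staircase is a cyclic interval when its middle block touches one of the two
    others, is empty, or is everything. *)
Section StairFrozen.
Variables (A : comNzRingType) (k n : nat) (p : 'M[A]_(k, n)).
Hypotheses (k_gt0 : (0 < k)%N) (k_lt_n : (k < n)%N).

Lemma stair_plucker_coef a b j c : (c < n)%N ->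
  (forall s, (s < k)%N -> stair k n a b j s = wrap k n c s) ->
  exists c, stair_plucker p a b j = minor p (coef_set k c).
Proof.
move=> cn eqs; exists (Ordinal cn); rewrite coef_sorted //; last exact: ltnW.
by apply: eq_detc => s sk; rewrite eqs.
Qed.

Lemma stair_plucker_frozen a b j : (a <= b <= k)%N -> (j <= n - k)%N ->
  [|| j == 0, j == (n - k), a == b | (a == 0) && (b == k)]%N ->
  exists c, stair_plucker p a b j = minor p (coef_set k c).
Proof.
move=> abk jn.
have split e : (e <= k)%N -> (forall s, (s < k)%N ->
    stair k n a b j s = if s < e then s else s + (n - k))%N ->
    exists c, stair_plucker p a b j = minor p (coef_set k c).
  move=> ek eqs; have [e0 | e0] := posnP e.
    by apply: (@stair_plucker_coef _ _ _ n.-1); [lia | move=> s sk; rewrite eqs // /wrap; if_lia].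
  by apply: (@stair_plucker_coef _ _ _ e.-1); [lia | move=> s sk; rewrite eqs // /wrap; if_lia].
case/or4P => [/eqP j0 | /eqP jE | /eqP ab | /andP[/eqP a0 /eqP bE]].
- by apply: (split b); [lia | move=> s sk; rewrite /stair; if_lia].
- by apply: (split a); [lia | move=> s sk; rewrite /stair; if_lia].
- by apply: (split b); [lia | move=> s sk; rewrite /stair; if_lia].
- apply: (@stair_plucker_coef _ _ _ (j + k.-1)); first by lia.
  by move=> s sk; rewrite /stair /wrap; if_lia.
Qed.

End StairFrozen.

(** * The homogeneous coordinate ring *)

Section CoordGr.
Variables (R : realType) (k n : nat).
Hypotheses (k_gt0 : (0 < k)%N) (k_lt_n : (k < n)%N).
Local Notation M := (coordM R k n).
Local Notation G := (genericM R k n).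
Let k_le_n : (k <= n)%N := ltnW k_lt_n.

Lemma coordGr_scalar (c : R[i]) : coordGr (c%:MP : M).
Proof. exact: generated_scalar. Qed.

Lemma coordGr0 : coordGr (0 : M).
Proof. by rewrite -(mpolyC0 _ R[i]); apply: generated_scalar. Qed.

Lemma coordGr1 : coordGr (1 : M).
Proof. by rewrite -(mpolyC1 _ R[i]); apply: generated_scalar. Qed.

Lemma coordGrD (f g : M) : coordGr f -> coordGr g -> coordGr (f + g).
Proof. exact: generated_add. Qed.

Lemma coordGrM (f g : M) : coordGr f -> coordGr g -> coordGr (f * g).
Proof. exact: generated_mul. Qed.

Lemma coordGr_sign m : coordGr ((-1) ^+ m : M).
Proof.
have -> : (-1) ^+ m = ((-1) ^+ m : R[i])%:MP :> M by rewrite rmorphXn rmorphN1.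
exact: generated_scalar.
Qed.

Lemma coordGr_prod (I : Type) (r : seq I) (f : I -> M) :
  (forall i, coordGr (f i)) -> coordGr (\prod_(i <- r) f i).
Proof. by move=> Gf; apply: big_ind => // [|x y]; [exact: coordGr1 | exact: coordGrM]. Qed.

Lemma coordGr_det m (B : 'M[M]_m) :
  (forall i j, coordGr (B i j)) -> coordGr (\det B).
Proof.
move=> GB; apply: big_ind => [|x y|s _]; [exact: coordGr0 | exact: coordGrD |].
by apply: coordGrM; [exact: coordGr_sign | exact: coordGr_prod].
Qed.

(** The columns can be sorted, at the cost of a sign, unless two of them agree. *)
Lemma coordGr_detc_nat_col (f : nat -> nat) : (forall s, (s < k)%N -> (f s < n)%N) ->
  coordGr (detc (fun s => nat_col G (f s))).
Proof.
move=> f_lt; pose g (s : 'I_k) := Ordinal (f_lt s (ltn_ord s)).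
have [g_inj | /injectivePn[s [t st gst]]] := boolP (injectiveb g); last first.
  rewrite (@detc_alternate _ _ _ s t) //; first exact: coordGr0.
  by congr (nat_col _ _); apply: (congr1 val gst).
move/injectiveP: g_inj => g_inj.
pose I := [set g s | s : 'I_k].
have cardI : #|I| = k by rewrite card_imset // card_ord.
have GI : coordGr (minor G I) by apply: generated_gen; exists I.
rewrite (minor_detc G cardI) in GI.
pose e s := nth 0%N [seq val c | c <- enum I] s.
have e_lt (s : 'I_k) : (s < size (enum I))%N by rewrite -cardE cardI.
have /fin_all_exists[h hE] (s : 'I_k) : exists t : 'I_k, f t = e s.
  have : nth (g s) (enum I) s \in I by rewrite -mem_enum mem_nth.
  case/imsetP => t _ gt; exists t.
  by rewrite /e (nth_map (g s)) // gt.
have h_inj : injective h.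
  move=> s t /(congr1 (fun t : 'I_k => f t)); rewrite !hE /e => /eqP.
  rewrite nth_uniq ?size_map // ?(map_inj_uniq val_inj) ?enum_uniq //.
  by move/eqP/val_inj.
have -> : detc (fun s => nat_col G (f s)) = (-1) ^+ (perm h_inj) *
    detc (fun s => nat_col G (nth 0%N [seq val c | c <- enum I] s)).
  have -> : detc (fun s => nat_col G (nth 0%N [seq val c | c <- enum I] s)) =
      \det (col_perm (perm h_inj) (cols_mx (fun s => nat_col G (f s)))).
    by congr (\det _); apply/matrixP => r s; rewrite !mxE permE hE.
  by rewrite col_permE det_mulmx det_perm odd_permV mulrCA -expr2 sqrr_sign mulr1.
by apply: coordGrM => //; apply: coordGr_sign.
Qed.

Lemma coordGr_detc_ext_col (f : nat -> nat) : coordGr (detc (fun s => ext_col G (f s))).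
Proof.
rewrite /ext_col (detc_scale _ (fun s => (-1) ^+ (k.-1 * (f s %/ n).+1))).
apply: coordGrM; first by apply: coordGr_prod => s; apply: coordGr_sign.
by apply: coordGr_detc_nat_col => s _; rewrite ltn_mod; lia.
Qed.

Lemma coordGr_gram c d : coordGr (gram G c d).
Proof.
rewrite /gram; set F := fun s => _.
have -> : detc F = detc (fun s => ext_col G (if (s < k.-1)%N then n + c - k.-1 + s else d)%N).
  by apply: eq_detc => s _; rewrite /F; case: ifP.
exact: coordGr_detc_ext_col.
Qed.

(** A Vandermonde matrix with increasing nodes has positive maximal minors. *)
Definition vandermonde_point : 'I_(k * n) -> R[i] :=
  fun i => mxvec (\matrix_(r < k, c < n) (c.+1%:R ^+ r)) 0 i.

Lemma meval_detc_increasing (f : nat -> nat) :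
  (forall s t, (s < t < k)%N -> (f s < f t)%N) ->
  (forall s, (s < k)%N -> (f s < n)%N) ->
  0 < (detc (fun s => nat_col G (f s))).@[vandermonde_point].
Proof.
move=> f_inc f_lt; rewrite -det_map_mx.
have -> : map_mx (meval vandermonde_point) (cols_mx (fun s => nat_col G (f s))) =
    Vandermonde k (\row_(s < k) ((f s).+1%:R : R[i])).
  apply/matrixP => r s; rewrite !mxE.
  have -> : f s = Ordinal (f_lt s (ltn_ord s)) by [].
  by rewrite nat_colE !mxE /= mevalXU /vandermonde_point mxvecE mxE.
rewrite det_Vandermonde; apply: Num.Theory.prodr_gt0 => s _.
apply: Num.Theory.prodr_gt0 => t st; rewrite !mxE Num.Theory.subr_gt0 Num.Theory.ltr_nat ltnS.
by apply: f_inc; rewrite st ltn_ord.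
Qed.

Lemma coef_neq0 (c : 'I_n) : minor G (coef_set k c) != 0.
Proof.
have : 0 < (minor G (coef_set k c)).@[vandermonde_point].
  rewrite (coef_nat_col _ k_gt0 k_le_n); apply: meval_detc_increasing.
    by move=> s t; apply: wrap_inc.
  by move=> s; apply: wrap_lt.
by apply: contraTneq => ->; rewrite meval0 Order.POrderTheory.ltxx.
Qed.

Lemma coordGr_detc_twisted_col (f : nat -> nat) : (forall s, (s < k)%N -> (f s < n)%N) ->
  coordGr (detc (fun s => twisted_col G (f s))).
Proof.
move=> f_lt.
have [r [s /(mulIf (coef_neq0 _)) ->]] :=
  detc_twisted_col_cofactor G k_gt0 k_le_n (erefl : f 0%N = Ordinal (f_lt 0%N k_gt0)).
apply: coordGrM; first exact: coordGr_sign.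
by apply: coordGr_det => i j; rewrite !mxE; apply: coordGr_gram.
Qed.

Lemma minor_map (A1 A2 : comNzRingType) (f : {rmorphism A1 -> A2})
    (p : 'M[A1]_(k, n)) (I : {set 'I_n}) :
  minor (map_mx f p) I = f (minor p I).
Proof.
rewrite /minor -det_map_mx; congr (\det _); apply/matrixP => r s; rewrite !mxE.
elim: (enum I) (s : nat) => [|c e IHe] [|m] //=; rewrite ?rmorph0 ?mxE //.
Qed.

Lemma twist_plucker (I : {set 'I_n}) : twist (plucker R k I) = minor (twist_mx G) I.
Proof.
rewrite /plucker; set lq := [tuple mxvec (twist_mx G) 0 i | i < (k * n)%N].
transitivity (minor (map_mx (comp_mpoly lq) G) I); first by rewrite minor_map.
congr (minor _ I); apply/matrixP => r c; rewrite !mxE /= comp_mpolyXU.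
by rewrite -tnth_nth tnth_mktuple mxvecE !mxE.
Qed.

Lemma twistD (f g : M) : twist (f + g) = twist f + twist g.
Proof. exact: rmorphD. Qed.

Lemma twistM (f g : M) : twist (f * g) = twist f * twist g.
Proof. exact: rmorphM. Qed.

Lemma twist0 : twist (0 : M) = 0.
Proof. exact: rmorph0. Qed.

Lemma twist1 : twist (1 : M) = 1.
Proof. exact: rmorph1. Qed.

Lemma twistC (c : R[i]) : twist (c%:MP : M) = c%:MP.
Proof. exact: comp_mpolyC. Qed.

Lemma nat_col_twist c : (c < n)%N -> nat_col (twist_mx G) c = twisted_col G c.
Proof.
by move=> cn; rewrite -(twist_col _ k_gt0 k_le_n (Ordinal cn)) -nat_colE.
Qed.

(** The entries of a twisted matrix are not in C[Gr], but twisted minors are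
    cofactors of matrices of Pluecker coordinates, by
    [detc_twisted_col_cofactor]. *)
Lemma coordGr_twist (f : M) : coordGr f -> coordGr (twist f).
Proof.
elim=> [c|_ [I [cardI ->]]|a b _ Ga _ Gb|a b _ Ga _ Gb].
- by rewrite twistC; apply: coordGr_scalar.
- rewrite twist_plucker (minor_detc _ cardI).
  pose e s := nth 0%N [seq val c | c <- enum I] s.
  have e_lt s : (s < k)%N -> (e s < n)%N.
    move=> sk; have se : (s < size [seq val c | c <- enum I])%N.
      by rewrite size_map -cardE cardI.
    by have /mapP[c _ eE] := mem_nth 0%N se; rewrite /e eE; apply: ltn_ord.
  rewrite (eq_detc (F' := fun s => twisted_col G (e s))); first exact: coordGr_detc_twisted_col.
  by move=> s sk; rewrite nat_col_twist // e_lt.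
- by rewrite twistD; apply: coordGrD.
- by rewrite twistM; apply: coordGrM.
Qed.

Lemma vertex_i_lt (v : vertex k n) : (vertex_i v < k)%N.
Proof. by case: v => [[i j]|] //=; apply: ltn_ord. Qed.

Lemma vertex_j_le (v : vertex k n) : (vertex_j v <= n - k)%N.
Proof. by case: v => [[i j]|] //=; apply: ltn_ord. Qed.

Lemma vertex_stair_lt (v : vertex k n) s : (s < k)%N ->
  (stair k n (vertex_i v) k (vertex_j v) s < n)%N.
Proof. by have := vertex_i_lt v; have := vertex_j_le v; rewrite /stair; if_lia. Qed.

Lemma vertex_stair_inc (v : vertex k n) s t : (s < t < k)%N ->
  (stair k n (vertex_i v) k (vertex_j v) s < stair k n (vertex_i v) k (vertex_j v) t)%N.
Proof. by have := vertex_i_lt v; have := vertex_j_le v; rewrite /stair; if_lia. Qed.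

Lemma minor_vertex (A : comNzRingType) (p : 'M[A]_(k, n)) (v : vertex k n) :
  minor p (vertex_set v) =
  detc (fun s => nat_col p (stair k n (vertex_i v) k (vertex_j v) s)).
Proof.
apply: minor_increasing; [exact: vertex_stair_inc | exact: vertex_stair_lt |].
move=> c; rewrite inE; have ik := vertex_i_lt v; have jn := vertex_j_le v.
apply/idP/hasP => [/orP[] cv | [s]].
- by exists (c : nat); rewrite ?mem_iota /stair; if_lia.
- by exists (c - vertex_j v)%N; rewrite ?mem_iota /stair; if_lia.
- by rewrite mem_iota /= add0n /stair; if_lia.
Qed.

Lemma plucker_vertex (v : vertex k n) :
  plucker R k (vertex_set v) = stair_plucker G (vertex_i v) k (vertex_j v).
Proof.
rewrite /plucker minor_vertex; apply: eq_detc => s sk.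
by rewrite ext_col_in // vertex_stair_lt.
Qed.

Lemma twist_vertex (v : vertex k n) :
  twist (plucker R k (vertex_set v)) = stair_twist G (vertex_i v) k (vertex_j v).
Proof.
rewrite twist_plucker minor_vertex; apply: eq_detc => s sk.
by rewrite nat_col_twist // vertex_stair_lt.
Qed.

Lemma plucker_vertex_pos (v : vertex k n) :
  0 < (plucker R k (vertex_set v)).@[vandermonde_point].
Proof.
rewrite /plucker minor_vertex.
by apply: meval_detc_increasing; [exact: vertex_stair_inc | exact: vertex_stair_lt].
Qed.

End CoordGr.

(** * The projection of twisted minors *)

Section StairProjection.
Variables (A : comNzRingType) (F : fieldType) (k n : nat) (p : 'M[A]_(k, n)).
Hypotheses (k_gt0 : (0 < k)%N) (k_lt_n : (k < n)%N).
Variables (Gr : A -> Prop) (pi : A -> F).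
Hypotheses (Gr1 : Gr 1) (GrD : forall f g, Gr f -> Gr g -> Gr (f + g)).
Hypothesis GrM : forall f g, Gr f -> Gr g -> Gr (f * g).
Hypothesis Gr_stair_plucker : forall a b j, Gr (stair_plucker p a b j).
Hypothesis Gr_stair_twist : forall i j, (i < k)%N -> (j <= n - k)%N -> Gr (stair_twist p i k j).
Hypothesis Gr_gram_coef : forall c, Gr (gram_coef p c).
Hypothesis Gr_cross_gram : forall i j, Gr (cross_gram p i j).
Hypotheses (pi1 : pi 1 = 1) (piD : forall f g, Gr f -> Gr g -> pi (f + g) = pi f + pi g).
Hypothesis piM : forall f g, Gr f -> Gr g -> pi (f * g) = pi f * pi g.
Hypothesis pi_coef : forall c : 'I_n, pi (minor p (coef_set k c)) = 1.

Lemma proj_prod_gram_coef m (f : nat -> nat) : (forall r, (r < m)%N -> (f r < n)%N) ->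
  Gr (\prod_(r < m) gram_coef p (f r)) /\ pi (\prod_(r < m) gram_coef p (f r)) = 1.
Proof.
move=> fn; apply: (big_rec (fun y => Gr y /\ pi y = 1)) => // r y _ [Gy piy].
split; first exact: GrM.
by rewrite (piM (Gr_gram_coef _) Gy) piy mulr1 (gram_coefE p k_gt0 k_lt_n (fn r (ltn_ord r))).
Qed.

Lemma proj_frozen a b j : (a <= b <= k)%N -> (j <= n - k)%N ->
  [|| j == 0, j == (n - k), a == b | (a == 0) && (b == k)]%N ->
  pi (stair_plucker p a b j) = 1.
Proof.
by move=> ab jn fr; have [c ->] := stair_plucker_frozen p k_gt0 k_lt_n ab jn fr.
Qed.

Lemma proj_twist_interval j : (j <= n - k)%N -> pi (stair_twist p 0 k j) = 1.
Proof.
move=> jn; have := congr1 pi (stair_twist_interval p k_gt0 k_lt_n jn).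
have [|_ ->] := @proj_prod_gram_coef k (fun r => j + r)%N; first by move=> r; lia.
have jk : (j + k.-1 < n)%N by lia.
rewrite (piM (Gr_stair_twist k_gt0 jn) (Gr_gram_coef _)).
by rewrite (gram_coefE p k_gt0 k_lt_n jk) pi_coef mulr1.
Qed.

(** Eliminate [cross_gram i j] between [stair_twist_lower] and [stair_twist_upper];
    all other factors are coefficients or the twist of an interval. *)
Lemma proj_twist_stair i j : (i < k)%N -> (j <= n - k)%N ->
  pi (stair_twist p i k j) = pi (stair_plucker p 0 i j).
Proof.
move=> ik jn; have ik' := ltnW ik.
have [|G1 pi_1] := @proj_prod_gram_coef i (fun r => j + r)%N; first by move=> r; lia.
have [|G2 pi_2] := @proj_prod_gram_coef i id; first by move=> r; lia.
have := congr1 pi (stair_twist_lower p k_gt0 k_lt_n ik' jn).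
have := congr1 pi (stair_twist_upper p k_gt0 k_lt_n ik' jn).
rewrite (piM (Gr_stair_twist ik jn) (Gr_stair_plucker _ _ _)) (piM (Gr_stair_twist k_gt0 jn) (Gr_stair_plucker _ _ _)).
rewrite (piM G1 (Gr_cross_gram _ _)) (piM G2 (Gr_cross_gram _ _)) pi_1 pi_2.
rewrite (proj_twist_interval jn).
rewrite (@proj_frozen i i j); [|lia|lia|by rewrite eqxx !orbT].
by rewrite !mul1r mulr1 => -> ->.
Qed.

(** Minors of [{1, ..., i - t}], an interval of length [k - i], and
    [{n - t + 1, ..., n}]: for [t = 0] an initial minor, for [t = i] the
    projection of a twisted one. *)
Definition flip_var (i j t : nat) : F := pi (stair_plucker p (i - t) (k - t) j).

Lemma flip_var_boundary i j t : (t <= i <= k)%N -> (j <= n - k)%N ->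
  [|| i == 0, i == k, j == 0 | j == (n - k)]%N -> flip_var i j t = 1.
Proof. by move=> ti jn bd; apply: proj_frozen; lia. Qed.

(** [stair_exchange] with [a = i - t] and [b = k - t]. *)
Lemma flip_var_exchange i j t : (t < i < k)%N -> (0 < j < n - k)%N ->
  flip_var i j t * flip_var i j t.+1 =
  flip_var i j.-1 t * flip_var i j.+1 t.+1 + flip_var i.-1 j t * flip_var i.+1 j t.+1.
Proof.
move=> ti jn; rewrite /flip_var.
have [-> ->] : (k - t.+1 = (k - t).-1)%N /\ (i.+1 - t.+1 = i - t)%N by lia.
have [-> ->] : (i - t.+1 = (i - t).-1)%N /\ (i.-1 - t = (i - t).-1)%N by lia.
have Gs := Gr_stair_plucker.
rewrite [RHS]addrC -!(piM (Gs _ _ _) (Gs _ _ _)) -(piD (GrM (Gs _ _ _) (Gs _ _ _)) (GrM (Gs _ _ _) (Gs _ _ _))).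
congr pi; rewrite [RHS]addrC [X in _ = _ + X]mulrC.
apply: (@stair_exchange _ k n (fun m => ext_col p (n + m)) (i - t) (k - t) j); lia.
Qed.


End StairProjection.

Section Projection.
Variables (R : realType) (k n : nat).
Hypotheses (k_gt0 : (0 < k)%N) (k_lt_n : (k < n)%N).
Variable pi : coordM R k n -> fracM R k n.
Hypothesis hpi : is_projection pi.
Local Notation G := (genericM R k n).
Local Notation M := (coordM R k n).

Lemma proj_1 : pi 1 = 1.
Proof. by case: hpi => -[]. Qed.

Lemma projD f g : coordGr f -> coordGr g -> pi (f + g) = pi f + pi g.
Proof. by case: hpi => -[_ piD _] _ _ _ _; apply: piD. Qed.

Lemma projM f g : coordGr f -> coordGr g -> pi (f * g) = pi f * pi g.
Proof. by case: hpi => -[_ _ piM] _ _ _ _; apply: piM. Qed.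

Lemma proj_0 : pi 0 = 0.
Proof.
apply: (addrI (pi 0)); rewrite -(projD (coordGr0 R k n) (coordGr0 R k n)) !addr0.
exact: erefl.
Qed.

Lemma proj_coef (c : 'I_n) : pi (minor G (coef_set k c)) = 1.
Proof. by case: hpi => _ _ _ pi_coef _; apply: pi_coef. Qed.

Lemma coordGr_stair_plucker a b j : coordGr (stair_plucker G a b j).
Proof. exact: coordGr_detc_ext_col. Qed.

Lemma coordGr_cross_gram i j : coordGr (cross_gram G i j).
Proof. by apply: coordGr_det => r s; rewrite mxE; apply: coordGr_gram. Qed.

Lemma coordGr_stair_twist i j : (i < k)%N -> (j <= n - k)%N -> coordGr (stair_twist G i k j).
Proof.
move=> ik jn; apply: coordGr_detc_twisted_col => // s sk.
by rewrite /stair; if_lia.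
Qed.

Lemma coordGr_gram_coef c : coordGr (gram_coef G c).
Proof. exact: coordGr_gram. Qed.

Lemma proj_twist i j : (i < k)%N -> (j <= n - k)%N ->
  pi (stair_twist G i k j) = pi (stair_plucker G 0 i j).
Proof.
apply: (proj_twist_stair k_gt0 k_lt_n (@coordGr1 R k n) (@coordGrM R k n)
  coordGr_stair_plucker coordGr_stair_twist coordGr_gram_coef coordGr_cross_gram proj_1 projM proj_coef).
Qed.

Lemma proj_vertex (v : vertex k n) : ~~ frozen v ->
  pi (plucker R k (vertex_set v)) = tofrac (plucker R k (vertex_set v)).
Proof. by case: hpi => _ _ _ _ piv; apply: piv. Qed.

Lemma frozen_cases (v : vertex k n) : frozen v ->
  [|| vertex_j v == 0, vertex_j v == (n - k) | vertex_i v == 0]%N.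
Proof.
rewrite /frozen; have := vertex_i_lt k_gt0 v; have := vertex_j_le v; lia.
Qed.

Lemma proj_vertex_frozen (v : vertex k n) : frozen v ->
  pi (plucker R k (vertex_set v)) = 1.
Proof.
move=> fv; have := frozen_cases fv.
have iv := vertex_i_lt k_gt0 v; have jv := vertex_j_le v => cv.
rewrite plucker_vertex //.
apply: (proj_frozen k_gt0 k_lt_n proj_coef); lia.
Qed.

Lemma proj_twist_frozen (v : vertex k n) : frozen v ->
  pi (twist (plucker R k (vertex_set v))) = 1.
Proof.
move=> fv; have := frozen_cases fv.
have iv := vertex_i_lt k_gt0 v; have jv := vertex_j_le v => cv.
rewrite twist_vertex // proj_twist //.
apply: (proj_frozen k_gt0 k_lt_n proj_coef); lia.
Qed.

Lemma initial_seed1_flip : initial_seed1 R k n = flip_seed k n (flip_var G pi) (fun _ _ => 0%N).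
Proof.
rewrite /initial_seed1 /principal_part /flip_seed; congr Seed; apply/funext => u.
  by rewrite /= /flip_var !subn0 -(proj_vertex (valP u)) plucker_vertex.
apply/funext => v; congr nat_of_bool.
rewrite /= /arrow (negPf (valP u)).
case: u v => [[[i j]|] // fu] [[[i' j']|] // fv] /=.
rewrite /height_arrow /flip_height /mut_coord /mut_i /mut_j /adj /=; lia.
Qed.

Definition image_seed (psi : M -> fracM R k n) : seed (mutable k n) (fracM R k n) :=
  Seed (fun v => psi (plucker R k (vertex_set (val v))))
       (seed_quiver (initial_seed1 R k n)).

Lemma tofrac_inj : injective (@tofrac M).
Proof. by move=> f g /eqP; rewrite tofrac_eq => /eqP. Qed.

Let pos := positive (@tofrac M) (meval (@vandermonde_point R k n)).

Lemma initial_seed1_positive v : pos (seed_var (initial_seed1 R k n) v).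
Proof. by apply: positive_iota; apply: plucker_vertex_pos. Qed.

(** Nonvanishing along the path is inherited from the positivity of the initial
    minors. *)
Lemma reach_twist : reachable xpred0 (initial_seed1 R k n)
  (flip_seed k n (flip_var G pi) (fun i _ => i)).
Proof.
rewrite initial_seed1_flip; apply: reach_final.
- exact: (flip_var_boundary k_gt0 k_lt_n proj_coef).
- exact: (flip_var_exchange k_gt0 k_lt_n (@coordGrM R k n) coordGr_stair_plucker projD projM).
- move=> s rs v; rewrite -initial_seed1_flip in rs.
  apply: (positive_neq0 tofrac_inj).
  exact: (positive_reachable tofrac_inj initial_seed1_positive rs).
Qed.

Definition twist_seed := image_seed (fun f => pi (twist f)).

(** [(i, j) -> (k - i, j)]; the remainder modulo [k] only serves to remain in
    ['I_k] for the frozen row [i = 0]. *)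
Definition vertex_opp (v : vertex k n) : vertex k n :=
  if v is Some (i, j) then Some (Ordinal (ltn_pmod (k - i) k_gt0), j) else None.

Lemma vertex_oppE v : ~~ frozen v ->
  vertex_i (vertex_opp v) = (k - vertex_i v)%N /\ vertex_j (vertex_opp v) = vertex_j v.
Proof.
case: v => [[i j]|] //=; rewrite negbK /= => ij.
by split=> //; rewrite modn_small; lia.
Qed.

Lemma vertex_oppK : involutive vertex_opp.
Proof.
case=> [[i j]|] //=; congr (Some (_, _)); apply: val_inj => /=.
have ik := ltn_ord i; have [i0 | i0] := posnP i.
  by rewrite i0 subn0 modnn subn0 modnn.
by rewrite (@modn_small (k - i)) ?modn_small; lia.
Qed.

Definition vertex_opp_perm : {perm vertex k n} := perm (can_inj vertex_oppK).

Lemma frozen_opp v : frozen (vertex_opp_perm v) = frozen v.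
Proof.
rewrite permE; suff op w : ~~ frozen w -> ~~ frozen (vertex_opp w).
  by apply/idP/idP; apply: contraTT => /op //; rewrite vertex_oppK.
move=> fw; have [ei ej] := vertex_oppE fw; move: fw; rewrite /frozen !negbK ei ej; lia.
Qed.

Definition mutable_opp : {perm mutable k n} :=
  restrict_perm (P := fun v => ~~ frozen v) (fun v => congr1 negb (frozen_opp v)).

Lemma mutable_oppE v : mut_i (mutable_opp v) = (k - mut_i v)%N /\
  mut_j (mutable_opp v) = mut_j v.
Proof.
by rewrite /mut_i /mut_j val_restrict permE; apply: vertex_oppE; exact: (valP v).
Qed.

Lemma twist_seed_relabels :
  relabels mutable_opp twist_seed (flip_seed k n (flip_var G pi) (fun i _ => i)).
Proof.
have opp := mutable_oppE.
split=> [v | u v].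
  have [vi vj] := opp v; have /andP[ik jn] := mut_coordP v.
  rewrite /= vi vj /flip_var subnn subKn; last by lia.
  rewrite (twist_vertex R k_gt0 k_lt_n).
  by apply: proj_twist; [apply: vertex_i_lt | apply: vertex_j_le].
have [ui uj] := opp u; have [vi vj] := opp v.
have := mut_coordP u; have := mut_coordP v.
rewrite /twist_seed /image_seed initial_seed1_flip /= /height_arrow /flip_height /= ui uj vi vj /adj => Hv Hu.
by congr nat_of_bool; lia.
Qed.

Lemma twist_seed_seed : seed_Gr1 twist_seed.
Proof.
apply: (is_seed_relabels (frozen := xpred0) (fun=> erefl) twist_seed_relabels).
exact: is_seed_reachable (is_seed_refl _ _) reach_twist.
Qed.

Lemma twist_seed_positive v : pos (seed_var twist_seed v).
Proof.
have [-> _] := twist_seed_relabels.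
exact: (positive_reachable tofrac_inj initial_seed1_positive reach_twist).
Qed.

End Projection.

(** * Evaluation of cluster variables *)

Section Evaluate.
Variables (R : realType) (k n : nat).
Hypotheses (k_gt0 : (0 < k)%N) (k_lt_n : (k < n)%N).
Local Notation M := (coordM R k n).
Variable psi : M -> fracM R k n.
Hypotheses (psi0 : psi 0 = 0) (psi1 : psi 1 = 1).
Hypothesis psiM : forall f g, coordGr f -> coordGr g -> psi (f * g) = psi f * psi g.

Lemma eval_frac_value h r :
  frac_value (@tofrac M) (@coordGr R k n) psi h r -> eval psi h = r.
Proof.
move=> hr; rewrite /eval; case: pselect => [ex_r|no_r].
  case: (cid ex_r) => r' /= hr'.
  have {}hr' : frac_value (@tofrac M) (@coordGr R k n) psi h r' by exact: hr'.
  exact: (frac_value_uniq (@tofrac_inj R k n) psi0 psiM hr' hr).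
by case: no_r; exists r; exact: hr.
Qed.

Lemma frac_value_tofrac f : coordGr f ->
  frac_value (@tofrac M) (@coordGr R k n) psi (tofrac f) (psi f).
Proof. by move=> Gf; exact: (frac_value_iota (@tofrac M) (@coordGr1 R k n) psi1 Gf). Qed.

Lemma coordGr_plucker_vertex (v : vertex k n) : coordGr (plucker R k (vertex_set v)).
Proof.
rewrite (plucker_vertex R k_gt0 k_lt_n); exact: coordGr_detc_ext_col.
Qed.

Hypothesis psi_frozen : forall v : vertex k n, frozen v ->
  psi (plucker R k (vertex_set v)) = 1.

(** The hypothesis on the frozen vertices is what makes the initial seed of C[Gr]
    and its image comparable; the rest is inherited along mutations. *)
Lemma specializes_initial :
  specializes (@tofrac M) (@coordGr R k n) psi (initial_seed R k n) (image_seed psi).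
Proof.
split=> [v fv | v | u v]; last exact: erefl.
  have := frac_value_tofrac (coordGr_plucker_vertex v).
  by rewrite (psi_frozen fv).
apply: frac_value_tofrac; exact: coordGr_plucker_vertex.
Qed.
End Evaluate.

Theorem proposition8p10 (R : realType) (k n : nat)
    (hk : (2 <= k <= n - 2)%N)
    (pi : coordM R k n -> fracM R k n) (hpi : is_projection pi) :
  (forall s : seed (vertex k n) (fracM R k n),
     seed_Gr s ->
     seed_Gr1 (map_seed (eval (fun f => pi (twist f)))
                        (principal_part (@frozen k n) s))) /\
  (forall x : fracM R k n,
     cluster_variable_Gr x ->
     cluster_variable_Gr1 (eval (fun f => pi (twist f)) x) /\
     exists2 y : fracM R k n,
       cluster_variable_Gr y & eval (fun f => pi (twist f)) x = eval pi y).
Proof.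
have k_gt0 : (0 < k)%N by lia.
have k_lt_n : (k < n)%N by lia.
have twG f := @coordGr_twist R k n k_gt0 k_lt_n f.
pose phi f := pi (twist f); rewrite -/phi.
have phi1 : phi 1 = 1 by rewrite /phi twist1 (proj_1 hpi).
have phi0 : phi 0 = 0 by rewrite /phi twist0 (proj_0 hpi).
have phiD f g : coordGr f -> coordGr g -> phi (f + g) = phi f + phi g.
  by move=> Gf Gg; rewrite /phi twistD (projD hpi (twG _ Gf) (twG _ Gg)).
have phiM f g : coordGr f -> coordGr g -> phi (f * g) = phi f * phi g.
  by move=> Gf Gg; rewrite /phi twistM (projM hpi (twG _ Gf) (twG _ Gg)).
have phi_frozen := proj_twist_frozen k_gt0 k_lt_n hpi.
have spec0 := specializes_initial k_gt0 k_lt_n phi1 phi_frozen.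
have part1 s : seed_Gr s ->
    seed_Gr1 (map_seed (eval phi) (principal_part (@frozen k n) s)).
  case=> [t [a [rt fa Hv Hq]]].
  have [t1 rt1 [_ tM tQ]] := specialize_reachable (@tofrac_inj R k n) (@coordGr1 R k n)
    (@coordGrD R k n) (@coordGrM R k n) phi0 phi1 phiD phiM spec0
    (twist_seed_positive k_gt0 k_lt_n hpi) rt.
  pose b := restrict_perm (P := fun v => ~~ frozen v) (fun v => congr1 negb (fa v)).
  have bE v : val (b v) = a (val v) by apply: val_restrict.
  apply: (is_seed_relabels (a := b) (frozen := xpred0) (t := t1) (fun=> erefl)).
    split=> [v | u v] /=.
      rewrite Hv -[sval v]/(val v) -bE.
      exact: (eval_frac_value phi0 phiM (tM (b v))).
    by rewrite Hq tQ !bE.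
  exact: is_seed_reachable (twist_seed_seed k_gt0 k_lt_n hpi) rt1.
split=> // x [s [v [ss fv ->]]].
have := part1 s ss; set s1 := map_seed _ _ => ss1.
pose v1 : mutable k n := exist (fun v => ~~ frozen v) v fv.
split; first by exists s1, v1.
case: ss1 => [t1 [b [rt1 _ Hv _]]].
have pi_spec : specializes (@tofrac _) (@coordGr R k n) pi (initial_seed R k n) (initial_seed1 R k n).
  have [sF sM sQ] := specializes_initial k_gt0 k_lt_n (proj_1 hpi) (proj_vertex_frozen k_gt0 k_lt_n hpi).
  split=> // u; have := sM u; rewrite /= (proj_vertex hpi) //; exact: (valP u).
have [t rt [_ tM _]] := lift_reachable (@tofrac_inj R k n) (@coordGr1 R k n)
    (@coordGrD R k n) (@coordGrM R k n) (proj_0 hpi) (proj_1 hpi) (projD hpi) (projM hpi) pi_spec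
    (@initial_seed1_positive R k n k_gt0 k_lt_n) rt1.
exists (seed_var t (val (b v1))).
  exists t, (val (b v1)); split=> //; last exact: (valP (b v1)).
  exact: is_seed_reachable (is_seed_refl _ _) rt.
rewrite (eval_frac_value (proj_0 hpi) (projM hpi) (tM (b v1))).
exact: Hv v1.
Qed.
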